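(* Let $\mathcal{L}$ be the operator $$\mathcal{L}=\frac{1}{V(x)}\sum_{i,j=1}^N\frac{\partial}{\partial x_i}\Big(V(x)\,a_{i,j}(x)\,\frac{\partial}{\partial x_j}\Big),\qquad x\in\mathbb{R}^N,$$ where $V\in C^\infty(\mathbb{R}^N,\mathbb{R})$ is positive, $a_{i,j}\in C^\infty(\mathbb{R}^N,\mathbb{R})$, and the matrix $A(x)=(a_{i,j}(x))_{i,j}$ is symmetric and positive semi-definite for every $x\in\mathbb{R}^N$. Assume that $A(x)\neq 0$ for every $x\in\mathbb{R}^N$ and that $\mathcal{L}$ is $C^\infty$-hypoelliptic in every open subset of $\mathbb{R}^N$. Suppose also that $c\in C^\infty(\mathbb{R}^N,\mathbb{R})$ is nonnegative on $\mathbb{R}^N$ (the case $c\equiv 0$ is allowed), and set $\mathcal{L}_c:=\mathcal{L}-c$. Then $\mathcal{L}_c$ satisfies the Weak Maximum Principle on every bounded open set $\Omega\subseteq\mathbb{R}^N$, that is: if $u\in C^2(\Omega,\mathbb{R})$, $\mathcal{L}_c u\geq 0$ on $\Omega$, and $\limsup_{x\to x_0}u(x)\leq 0$ for every $x_0\in\partial\Omega$, then $u\leq 0$ on $\Omega$. As a consequence, if $\Omega\subseteq\mathbb{R}^N$ is bounded (and open), and if $u\in C^2(\Omega)\cap C(\overline{\Omega})$ is nonnegative and such that $\mathcal{L}_c u\geq 0$ on $\Omega$, then $\sup_{\overline{\Omega}}u=\sup_{\partial\Omega}u$.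
   Context: A linear differential operator $L$ with smooth coefficients is $C^\infty$-hypoelliptic in an open set $\Omega\subseteq\mathbb{R}^N$ if, for every distribution $u\in\mathcal{D}'(\Omega)$, every open set $U\subseteq\Omega$ and every $f\in C^\infty(U,\mathbb{R})$, the equation $Lu=f$ in $U$ (in the sense of distributions) implies that $u$ is (a function-type distribution associated with) a $C^\infty$ function on $U$. The operator $\mathcal{L}-c$ acts as $u\mapsto\mathcal{L}u-c\,u$. *)

(* Defs.v *)
From HB Require Import structures.
From mathcomp Require Import all_boot all_order all_algebra.
From mathcomp Require Import all_classical all_reals all_analysis.

Set Implicit Arguments.
Unset Strict Implicit.
Unset Printing Implicit Defensive.

Import Order.TTheory GRing.Theory Num.Theory.
Import numFieldNormedType.Exports.

Local Open Scope classical_set_scope.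
Local Open Scope ring_scope.

Section tcons_measure.
Context {R : realType} (n : nat).
Local Notation tupleR n := (n.-tuple (measurableTypeR R)).

Definition tcons (p : measurableTypeR R * tupleR n) : tupleR n.+1 :=
  [the tupleR n.+1 of p.1 :: p.2].

Definition tuncons (t : tupleR n.+1) : measurableTypeR R * tupleR n :=
  (thead t, [tuple of behead t]).

Lemma tconsK : cancel tcons tuncons.
Proof.
move=> [x t]; rewrite /tuncons /tcons /= theadE.
by congr pair; apply: val_inj.
Qed.

Lemma measurable_tcons : measurable_fun setT tcons.
Proof. exact: measurable_cons. Qed.

Lemma measurable_tuncons : measurable_fun setT tuncons.
Proof.
apply: measurable_fun_pair; first exact: measurable_tnth.
exact: measurable_behead.
Qed.

Variable m : {sigma_finite_measure set (tupleR n) -> \bar R}.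

Definition tcons_measure : set (tupleR n.+1) -> \bar R :=
  pushforward (lebesgue_measure \x m)%E tcons.

Let tcons_measure0 : tcons_measure set0 = 0%E.
Proof. by rewrite /tcons_measure /pushforward preimage_set0 measure0. Qed.

Let tcons_measure_ge0 A : (0 <= tcons_measure A)%E.
Proof. by rewrite /tcons_measure /pushforward measure_ge0. Qed.

Let tcons_measure_sigma_additive : semi_sigma_additive tcons_measure.
Proof.
move=> F mF tF mUF; rewrite /tcons_measure /pushforward preimage_bigcup.
have mpre B : measurable B -> measurable (tcons @^-1` B).
  by move=> mB; rewrite -[X in measurable X]setTI; exact: measurable_tcons.
apply: measure_semi_sigma_additive.
- by move=> k; exact: mpre.
- apply/trivIsetP => /= i j _ _ ij; rewrite -preimage_setI.
  by move/trivIsetP : tF => /(_ _ _ _ _ ij) ->//; rewrite preimage_set0.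
- by rewrite -preimage_bigcup; exact: mpre.
Qed.

HB.instance Definition _ := isMeasure.Build _ _ _ tcons_measure
  tcons_measure0 tcons_measure_ge0 tcons_measure_sigma_additive.

Let tcons_measure_sigma_finite : sigma_finite setT tcons_measure.
Proof.
have /sigma_finiteP[F [TF ndF Foo]] := sigma_finiteT (@lebesgue_measure R).
have /sigma_finiteP[G [TG ndG Goo]] := sigma_finiteT m.
exists (fun k => tuncons @^-1` (F k `*` G k)).
  rewrite -preimage_bigcup; apply/esym/seteqP; split=> // t _ /=.
  have [i _ Fi] : (\bigcup_i F i) (tuncons t).1 by rewrite -TF.
  have [j _ Gj] : (\bigcup_i G i) (tuncons t).2 by rewrite -TG.
  exists (maxn i j) => //; split.
  - by move: Fi; exact/subsetPset/ndF/leq_maxl.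
  - by move: Gj; exact/subsetPset/ndG/leq_maxr.
move=> k; have [mF Fk] := Foo k; have [mG Gk] := Goo k; split.
  rewrite -[X in measurable X]setTI; apply: measurable_tuncons => //.
  exact: measurableX.
rewrite /tcons_measure /pushforward -comp_preimage (_ : _ \o _ = id).
  by rewrite preimage_id product_measure1E// lte_mul_pinfty// ge0_fin_numE.
by apply/funext => p; exact: tconsK.
Qed.

HB.instance Definition _ := Measure_isSigmaFinite.Build _ _ _ tcons_measure
  tcons_measure_sigma_finite.

End tcons_measure.

(* The n-fold product of the Lebesgue measure on R, as a Borel measure on
   n-tuples; on the one-point space of 0-tuples it is the unit mass. *)
Fixpoint tuple_lebesgue (R : realType) (n : nat) :
    {sigma_finite_measure set (n.-tuple (measurableTypeR R)) -> \bar R} :=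
  match n with
  | 0 => dirac ([tuple] : 0.-tuple (measurableTypeR R))
  | n'.+1 => tcons_measure (tuple_lebesgue R n')
  end.

Section tuple_lebesgue_theory.
Context {R : realType}.
Local Notation tupleR n := (n.-tuple (measurableTypeR R)).

Lemma tuple_lebesgue_box n (A : 'I_n -> set (measurableTypeR R)) :
  (forall i, measurable (A i)) ->
  tuple_lebesgue R n [set t | forall i, A i (tnth t i)] =
  (\prod_(i < n) lebesgue_measure (A i))%E.
Proof.
have mbox k (B : 'I_k -> set (measurableTypeR R)) :
    (forall i, measurable (B i)) ->
    measurable ([set t | forall i, B i (tnth t i)] : set (tupleR k)).
  move=> mB.
  rewrite [X in measurable X](_ : _ = \bigcap_(i in [set: 'I_k])
      ((@tnth k (measurableTypeR R) ^~ i) @^-1` B i)).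
    apply: fin_bigcap_measurable; first exact: finite_finset.
    by move=> i _; rewrite -[X in measurable X]setTI; exact: measurable_tnth.
  by apply/seteqP; split=> t /= h i; [move=> _; exact: h|exact: h].
elim: n A => [|n IH] A mA.
  rewrite big_ord0 /= diracE (_ : _ \in _ = true)//.
  by apply/mem_set => -[].
rewrite /= /tcons_measure /pushforward [X in product_measure1 _ _ X](_ : _ =
    A ord0 `*` [set t | forall i, A (lift ord0 i) (tnth t i)]).
  rewrite product_measure1E//; last exact: (mbox _ (fun i => A (lift ord0 i))).
  rewrite (IH (fun i => A (lift ord0 i))) ?big_ord_recl// => i; exact: mA.
apply/seteqP; split=> -[x t] /=.
- move=> h; split; first by have := h ord0; rewrite tnth0.
  by move=> i /=; have := h (lift ord0 i); rewrite tnthS.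
- move=> [h0 h1] i; have [j ->|->] := unliftP ord0 i.
    by rewrite tnthS; exact: h1.
  by rewrite tnth0.
Qed.

End tuple_lebesgue_theory.

Section euclidean_space.
Context {R : realType} {N : nat}.
Local Notation E := 'rV[R]_N.

Definition row_of_tuple (t : N.-tuple (measurableTypeR R)) : E :=
  \row_i tnth t i.

(* Lebesgue integral over a subset of R^N; the measure lives on tuples because
   row vectors carry no sigma-algebra. *)
Definition integral_rV (U : set E) (f : E -> R) : R :=
  Rintegral (tuple_lebesgue R N) (row_of_tuple @^-1` U) (f \o row_of_tuple).

Definition boundary (A : set E) : set E := closure A `\` interior A.

Definition partial (i : 'I_N) (f : E -> R) : E -> R := 'D_(delta_mx 0 i) f.

Fixpoint Ck (k : nat) (U : set E) (f : E -> R) : Prop :=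
  (forall x, U x -> {for x, continuous f}) /\
  match k with
  | 0 => True
  | k'.+1 => forall i, (forall x, U x -> derivable f x (delta_mx 0 i)) /\
                       Ck k' U (partial i f)
  end.

Definition smooth (U : set E) (f : E -> R) : Prop := forall k, Ck k U f.

Definition supported_in (K : set E) (f : E -> R) : Prop :=
  forall x, ~ K x -> f x = 0.

Definition test_function (U : set E) (phi : E -> R) : Prop :=
  smooth setT phi /\
  exists K, [/\ compact K, K `<=` U & supported_in K phi].

Definition iter_partial (s : seq 'I_N) (f : E -> R) : E -> R :=
  foldr partial f s.

(* The sum over all words of length at most m bounds the usual sum over
   multi-indices of order at most m from both sides up to a constant. *)
Definition Ck_norm (m : nat) (phi : E -> R) : R :=
  \sum_(k < m.+1) \sum_(s : k.-tuple 'I_N)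
    sup [set `|iter_partial s phi x| | x in setT].

(* Only the values of T on test functions of Omega are meaningful. *)
Definition distribution (Omega : set E) (T : (E -> R) -> R) : Prop :=
  (forall a phi psi, test_function Omega phi -> test_function Omega psi ->
     T (fun x => a * phi x + psi x) = a * T phi + T psi) /\
  (forall K, compact K -> K `<=` Omega ->
     exists C m, forall phi, smooth setT phi -> supported_in K phi ->
       `|T phi| <= C * Ck_norm m phi).

Definition distr_mul (g : E -> R) (T : (E -> R) -> R) : (E -> R) -> R :=
  fun phi => T (fun x => g x * phi x).

Definition distr_partial (i : 'I_N) (T : (E -> R) -> R) : (E -> R) -> R :=
  fun phi => - T (partial i phi).

Definition distr_of_fun (U : set E) (f : E -> R) : (E -> R) -> R :=
  fun phi => integral_rV U (fun x => f x * phi x).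

Definition distr_eq (U : set E) (S T : (E -> R) -> R) : Prop :=
  forall phi, test_function U phi -> S phi = T phi.

(* L is the action of the operator on distributions. *)
Definition hypoelliptic (L : ((E -> R) -> R) -> ((E -> R) -> R))
    (Omega : set E) : Prop :=
  forall u, distribution Omega u ->
  forall U f, open U -> U `<=` Omega -> smooth U f ->
    distr_eq U (L u) (distr_of_fun U f) ->
    exists g, smooth U g /\ distr_eq U u (distr_of_fun U g).

Definition psd_mx (M : 'M[R]_N) : Prop :=
  forall v : 'rV[R]_N, 0 <= (v *m M *m v^T) 0 0.

Definition div_op (V : E -> R) (A : E -> 'M[R]_N) (u : E -> R) : E -> R :=
  fun x => (V x)^-1 *
    \sum_i \sum_j partial i (fun y => V y * A y i j * partial j u y) x.

(* The same operator, with multiplication and derivatives taken in the sense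
   of distributions. *)
Definition div_op_distr (V : E -> R) (A : E -> 'M[R]_N)
    (T : (E -> R) -> R) : (E -> R) -> R :=
  distr_mul (fun x => (V x)^-1) (fun phi =>
    \sum_i \sum_j
      distr_partial i (distr_mul (fun y => V y * A y i j)
                                 (distr_partial j T)) phi).

Definition div_op_sub (V : E -> R) (A : E -> 'M[R]_N) (c : E -> R)
    (u : E -> R) : E -> R :=
  fun x => div_op V A u x - c x * u x.

Definition weak_maximum_principle (P : (E -> R) -> E -> R)
    (Omega : set E) : Prop :=
  forall u, Ck 2 Omega u ->
    (forall x, Omega x -> 0 <= P u x) ->
    (forall x0, boundary Omega x0 ->
       (limf_esup (EFin \o u) (within Omega (nbhs x0)) <= 0)%E) ->
    forall x, Omega x -> u x <= 0.

End euclidean_space.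

(* Main.v *)
Require Import Defs.
From HB Require Import structures.
From mathcomp Require Import all_boot all_order all_algebra.
From mathcomp Require Import all_classical all_reals all_analysis.
From mathcomp Require Import measurable_realfun ring lra.

Import Order.TTheory GRing.Theory Num.Theory.
Import numFieldNormedType.Exports.
Local Open Scope classical_set_scope.
Local Open Scope ring_scope.

(** The maximum principle reduces to the existence, on each compact set [K], of a
    smooth function [phi] with [L phi > 0] on [K] ([strict_subsolution]), where [L] is
    the operator without the zero-order term.  Given such a [phi] for the closure of
    [Omega], a function [u] with [L u - c u >= 0] that becomes positive is corrected by
    a small multiple of [phi] minus a constant: the result has a positive maximum inside
    [Omega], where the second-order test [div_op_max] gives [L <= 0], whereas
    [L u + eps * L phi > c u >= 0].

    To find [phi], suppose that there is none.  Then no function [L psi] is positive on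
    all of [K], and the Hahn-Banach theorem [hahn_banach] separates the space of these
    functions from the cone of positive functions: some nonzero functional [l], bounded
    by the supremum over [K], vanishes on every [L psi].  As [L] is symmetric for the
    density [V], the distribution [phi |-> l (phi / V)] is annihilated by [L]
    ([div_op_distrE]).  By hypoellipticity it is a smooth function [g], and [g] vanishes
    off [K].  It remains to see that a smooth compactly supported solution [g] of
    [L g = 0] is zero ([invariant_functional_eq0]).

    The energy identity [compact_kernel_flat] gives [A grad g = 0].  Consequently every
    [C^1] function of [g] is again a distributional solution, and is therefore smooth by
    hypoellipticity.  For [(g - t) * `|g - t|], with [t] the value of [g] at a point [x],
    smoothness at [x] forces the gradient of [g] to vanish at [x] ([flat_grad_eq0]).
    So [g] is constant along lines, and is zero because of its compact support.

    The supporting theory consists of the calculus of iterated partial derivatives, of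
    smooth bumps, and of integration over row vectors, where integration by parts
    follows from Fubini's theorem along one coordinate ([integral_tuple_lines0]). *)

Set Implicit Arguments.
Unset Strict Implicit.
Unset Printing Implicit Defensive.

(** * Hahn-Banach through minimal sublinear functionals *)

Section hahn_banach.
Context {R : realType} {E : lmodType R}.

Definition subspace (D : set E) : Prop :=
  D 0 /\ forall (a : R) x y, D x -> D y -> D (a *: x + y).

Definition sublinear_on (D : set E) (p : E -> R) : Prop :=
  (forall x y, D x -> D y -> p (x + y) <= p x + p y) /\
  (forall (a : R) x, 0 < a -> D x -> p (a *: x) <= a * p x).

Definition linear_on (D : set E) (p : E -> R) : Prop :=
  forall (a : R) x y, D x -> D y -> p (a *: x + y) = a * p x + p y.

Variable D : set E.
Hypothesis subD : subspace D.

Let D0 : D 0. Proof. exact: subD.1. Qed.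

Let DZ (a : R) x : D x -> D (a *: x).
Proof. by move=> Dx; rewrite -[X in D X]addr0; apply: subD.2. Qed.

Let DD x y : D x -> D y -> D (x + y).
Proof. by move=> Dx Dy; rewrite -(scale1r x); apply: subD.2. Qed.

Let DN x : D x -> D (- x).
Proof. by move=> Dx; rewrite -scaleN1r; apply: DZ. Qed.

Lemma sublinear_on0 p : sublinear_on D p -> p 0 = 0.
Proof.
move=> [pD pZ]; have := pZ 2 0 (ltr0Sn _ _) D0; have := pZ 2^-1 0 _ D0.
by rewrite !scaler0 invr_gt0 ltr0Sn => /(_ isT); lra.
Qed.

Lemma sublinear_onN p x : sublinear_on D p -> D x -> - p (- x) <= p x.
Proof.
move=> sp Dx; have := sp.1 x (- x) Dx (DN Dx).
by rewrite subrr (sublinear_on0 sp); lra.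
Qed.

(** Lowering [p] along a convex cone [G] of pairs [(w, r)] with [r <= p w]: the
    infimal convolution is still sublinear, and it takes a value at most [- r]
    at [- w].  The cone of multiples of [(y, p y)] makes [p] odd at [y], and the
    cone [W * {0}] makes it nonpositive on [W]. *)
Lemma sublinear_on_lower (p : E -> R) (G : set (E * R)) :
  sublinear_on D p ->
  G (0, 0) ->
  (forall g, G g -> D g.1 /\ g.2 <= p g.1) ->
  (forall g h, G g -> G h -> G (g.1 + h.1, g.2 + h.2)) ->
  (forall (a : R) g, 0 < a -> G g -> G (a *: g.1, a * g.2)) ->
  exists q, [/\ sublinear_on D q, (forall x, D x -> q x <= p x) &
    forall g, G g -> q (- g.1) <= - g.2].
Proof.
move=> sp G0 Gp GD GZ.
pose S x := [set p (x + g.1) - g.2 | g in G].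
pose q x := inf (S x).
have lbS x : D x -> has_inf (S x).
  move=> Dx; split; first by exists (p (x + 0) - 0); exists (0, 0).
  exists (- p (- x)) => _ [g Gg <-].
  have [Dg gp] := Gp g Gg.
  have := sp.1 (x + g.1) (- x) (DD Dx Dg) (DN Dx).
  by rewrite addrAC subrr add0r; lra.
have qle x g : D x -> G g -> q x <= p (x + g.1) - g.2.
  by move=> Dx Gg; apply: ge_inf; [exact: (lbS x Dx).2|exists g].
have leq x r : D x -> (forall g, G g -> r <= p (x + g.1) - g.2) -> r <= q x.
  move=> Dx h; apply: lb_le_inf; first exact: (lbS x Dx).1.
  by move=> _ [g Gg <-]; exact: h.
exists q; split.
- split=> [x y Dx Dy|a x a0 Dx].
    rewrite -lerBlDr; apply: (leq) => // g Gg.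
    suff : q (x + y) - (p (x + g.1) - g.2) <= q y by lra.
    apply: (leq) => // h Gh.
    have [Dg _] := Gp g Gg; have [Dh _] := Gp h Gh.
    have := qle (x + y) _ (DD Dx Dy) (GD g h Gg Gh).
    have := sp.1 (x + g.1) (y + h.1) (DD Dx Dg) (DD Dy Dh).
    by rewrite /= addrACA; lra.
  rewrite -ler_pdivrMl//; apply: (leq) => // g Gg.
  rewrite ler_pdivrMl//.
  have [Dg _] := Gp g Gg.
  have := qle (a *: x) _ (DZ a Dx) (GZ a g a0 Gg).
  have := sp.2 a (x + g.1) a0 (DD Dx Dg).
  by rewrite scalerDr /= mulrBr; lra.
- by move=> x Dx; have := qle x _ Dx G0; rewrite /= addr0 subr0.
- move=> g Gg; have := qle (- g.1) g (DN (Gp g Gg).1) Gg.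
  by rewrite addNr (sublinear_on0 sp) sub0r.
Qed.

(** Zorn: along a chain the infimum is finite because [- p (- x)] bounds every
    sublinear functional below [p]. *)
Lemma minimal_sublinear_on (p : E -> R) : sublinear_on D p ->
  exists m, [/\ sublinear_on D m, (forall x, D x -> m x <= p x) &
    forall q, sublinear_on D q -> (forall x, D x -> q x <= m x) ->
      forall x, D x -> m x <= q x].
Proof.
move=> sp.
pose T := {q : E -> R | sublinear_on D q /\ forall x, D x -> q x <= p x}.
have pP : sublinear_on D p /\ forall x, D x -> p x <= p x by split.
pose Rel (s t : T) := `[< forall x, D x -> sval t x <= sval s x >].
have [||A Atot|m maxm] := @ZL_preorder T (exist _ p pP) Rel.
- by move=> t; apply/asboolP.
- move=> r s t /asboolP rs /asboolP st; apply/asboolP => x Dx.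
  exact: le_trans (st x Dx) (rs x Dx).
- have [[t0 At0]|A0] := pselect (exists t, A t); last first.
    by exists (exist _ p pP) => s As; exfalso; apply: A0; exists s.
  pose S x := [set sval t x | t in A].
  have infS x : D x -> has_inf (S x).
    move=> Dx; split; first by exists (sval t0 x), t0.
    exists (- p (- x)) => _ [t At <-].
    have [st tp] := svalP t.
    by apply: le_trans (sublinear_onN st Dx); rewrite lerN2 tp//; exact: DN.
  pose q x := inf (S x).
  have qle x t : D x -> A t -> q x <= sval t x.
    by move=> Dx At; apply: ge_inf; [exact: (infS x Dx).2|exists t].
  have leq x r : D x -> (forall t, A t -> r <= sval t x) -> r <= q x.
    move=> Dx h; apply: lb_le_inf; first exact: (infS x Dx).1.
    by move=> _ [t At <-]; exact: h.
  have qP : sublinear_on D q /\ forall x, D x -> q x <= p x.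
    split; last first.
      by move=> x Dx; apply: le_trans (qle x t0 Dx At0) _; exact: (svalP t0).2.
    split=> [x y Dx Dy|a x a0 Dx].
      rewrite -lerBlDr; apply: (leq) => // s As.
      suff : q (x + y) - sval s x <= q y by lra.
      apply: (leq) => // t At.
      have [u [Au us ut]] : exists u, [/\ A u, sval u x <= sval s x &
          sval u y <= sval t y].
        have [/asboolP st|/asboolP ts] := Atot s t As At.
          by exists t; split => //; exact: st.
        by exists s; split => //; exact: ts.
      have := (svalP u).1.1 x y Dx Dy; have := qle _ _ (DD Dx Dy) Au; lra.
    rewrite -ler_pdivrMl//; apply: (leq) => // t At; rewrite ler_pdivrMl//.
    exact: le_trans (qle _ _ (DZ a Dx) At) ((svalP t).1.2 a x a0 Dx).
  by exists (exist _ q qP) => s As; apply/asboolP => x Dx; exact: qle.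
- have [sm mp] := svalP m.
  exists (sval m); split => // q sq qm x Dx.
  have qP : sublinear_on D q /\ forall x, D x -> q x <= p x.
    by split => // z Dz; exact: le_trans (qm z Dz) (mp z Dz).
  have /asboolP mq : Rel (exist _ q qP) m.
    by apply: maxm; apply/asboolP.
  exact: mq.
Qed.

(** A minimal sublinear functional is odd, since lowering it along the ray of [y]
    cannot decrease it any more, and an odd sublinear functional is linear. *)
Theorem hahn_banach (p : E -> R) (W : set E) :
  sublinear_on D p -> subspace W -> W `<=` D ->
  (forall w, W w -> 0 <= p w) ->
  exists l, [/\ linear_on D l, (forall x, D x -> l x <= p x) &
    forall w, W w -> l w = 0].
Proof.
move=> sp [W0 WL] WD Wp.
have WZ (a : R) x : W x -> W (a *: x).
  by move=> Wx; rewrite -[X in W X]addr0; apply: WL.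
(* [q] is [p] lowered to be nonpositive on [W]; every functional below [q]
   vanishes there. *)
have [|g [Wg g2]|g h [Wg g2] [Wh h2]|a g a0 [Wg g2]|q [sq qp qW]] :=
    @sublinear_on_lower p [set g | W g.1 /\ g.2 = 0] sp.
- by split.
- by rewrite g2; split; [exact: WD|exact: Wp].
- by rewrite /= g2 h2 addr0; split => //; rewrite -(scale1r g.1); exact: WL.
- by rewrite /= g2 mulr0; split => //; exact: WZ.
have [m [sm mq minm]] := minimal_sublinear_on sq.
have oddm y : D y -> m (- y) = - m y.
  move=> Dy; apply/eqP; rewrite eq_le; apply/andP; split; last first.
    by rewrite lerNl; apply: sublinear_onN.
  have [|g [t t0 ->]|g h [s s0 ->] [t t0 ->]|a g a0 [t t0 ->]|r [sr rm rG]] :=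
      @sublinear_on_lower m
        [set g | exists2 t, 0 <= t & g = (t *: y, t * m y)] sm.
  - by exists 0; rewrite // scale0r mul0r.
  - split; first exact: DZ.
    move: t0; rewrite le_eqVlt => /predU1P[<-|t0].
      by rewrite /= scale0r mul0r (sublinear_on0 sm).
    rewrite /= -ler_pdivlMl//.
    have := sm.2 t^-1 (t *: y); rewrite invr_gt0 scalerA mulVf ?gt_eqF// scale1r.
    by move=> /(_ t0 (DZ _ Dy)).
  - by exists (s + t); [exact: addr_ge0|rewrite /= scalerDl mulrDl].
  - by exists (a * t); [rewrite mulr_ge0// ltW|rewrite /= scalerA mulrA].
  apply: le_trans (minm r sr rm _ (DN Dy)) _.
  by have := rG (y, m y); apply; exists 1; rewrite // scale1r mul1r.
have addm x y : D x -> D y -> m (x + y) = m x + m y.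
  move=> Dx Dy; apply/eqP; rewrite eq_le sm.1//=.
  have := sm.1 (x + y) (- y) (DD Dx Dy) (DN Dy).
  by rewrite addrK oddm//; lra.
have posm (a : R) x : 0 < a -> D x -> m (a *: x) = a * m x.
  move=> a0 Dx; apply/eqP; rewrite eq_le sm.2//=.
  have := sm.2 a (- x) a0 (DN Dx); rewrite scalerN !oddm//; first by lra.
  exact: DZ.
exists m; split.
- move=> a x y Dx Dy; rewrite addm//; last exact: DZ.
  congr (_ + _); have [a0|a0|->] := ltgtP a 0; last first.
  + by rewrite scale0r mul0r (sublinear_on0 sm).
  + exact: posm.
  rewrite -[a in LHS]opprK scaleNr oddm ?posm ?oppr_gt0//; first lra.
  exact: DZ.
- by move=> x Dx; exact: le_trans (mq x Dx) (qp x Dx).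
- have h w : W w -> m w <= 0.
    move=> Ww; apply: le_trans (mq w (WD _ Ww)) _.
    have := qW (- w, 0); rewrite /= opprK oppr0; apply; split => //.
    by rewrite -scaleN1r; exact: WZ.
  move=> w Ww; apply/eqP; rewrite eq_le h//=.
  have := h (- w); rewrite -[X in W X]scaleN1r oddm; last exact: WD.
  by move=> /(_ (WZ _ _ Ww)); lra.
Qed.

End hahn_banach.

(** * Calculus of iterated partial derivatives *)

Section lines.
Context {R : realType} {V W : normedModType R}.

(** A derivative along [v] is the derivative of a function of one real variable,
    so that the mean value theorem and the chain rule become available. *)
Lemma is_derive_line (f : V -> W) (x v : V) (s : R) (df : W) :
  is_derive (s *: v + x) v f df <->
  is_derive s (1 : R) (fun h : R => f (h *: v + x)) df.
Proof.
have E : (fun h : R => h^-1 *: ((f \o shift (s *: v + x)) (h *: v) -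
    f (s *: v + x))) = (fun h : R => h^-1 *:
      (((fun h : R => f (h *: v + x)) \o shift s) (h *: (1 : R)) -
        f (s *: v + x))).
  apply/funext => h /=; congr (_ *: (f _ - _)).
  by rewrite [h *: 1]mulr1 scalerDl addrA.
split=> -[d1 d2]; apply: DeriveDef.
- by rewrite /derivable -E.
- by rewrite -d2 /derive -E.
- by rewrite /derivable E.
- by rewrite -d2 /derive E.
Qed.

Lemma is_derive_line0 (f : V -> W) (x v : V) (df : W) :
  is_derive x v f df <-> is_derive 0 (1 : R) (fun h : R => f (h *: v + x)) df.
Proof. by rewrite -is_derive_line scale0r add0r. Qed.

End lines.

Section chain.
Context {R : realType} {V : normedModType R}.

Lemma is_derive_chain (h : R -> R) (f : V -> R) (x v : V) (dh df : R) :
  is_derive (f x) 1 h dh -> is_derive x v f df ->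
  is_derive x v (h \o f) (dh * df).
Proof.
move=> dhf /is_derive_line0 dfx; apply/is_derive_line0.
have -> : (fun s : R => (h \o f) (s *: v + x)) =
   h \o (fun s : R => f (s *: v + x)) by [].
have dh0 : is_derive (f (0 *: v + x)) 1 h dh by rewrite scale0r add0r.
apply: DeriveDef.
  by apply/derivable1_diffP/differentiable_comp;
    apply/derivable1_diffP; apply: ex_derive.
rewrite -derive1E derive1_comp ?derive1E ?derive_val//.
Qed.

End chain.

Section Ck_theory.
Context {R : realType} {N : nat}.
Local Notation E := 'rV[R]_N.
Implicit Types (U : set E) (f g : E -> R) (k : nat) (i : 'I_N).

Lemma Ck_continuous k U f x : Ck k U f -> U x -> {for x, continuous f}.
Proof. by case: k => [|k] [+ _]; exact. Qed.

Lemma Ck_derivable k U f i x :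
  Ck k.+1 U f -> U x -> derivable f x (delta_mx 0 i).
Proof. by move=> [_ /(_ i)[+ _]]; exact. Qed.

Lemma Ck_is_derive k U f i x :
  Ck k.+1 U f -> U x -> is_derive x (delta_mx 0 i) f (partial i f x).
Proof. by move=> kf Ux; apply: derivableP; exact: Ck_derivable kf Ux. Qed.

Lemma Ck_partial k U f i : Ck k.+1 U f -> Ck k U (partial i f).
Proof. by move=> [_ /(_ i)[]]. Qed.

Lemma Ck_pred k U f : Ck k.+1 U f -> Ck k U f.
Proof.
elim: k f => [|k IH] f [cf df]; split => // i.
by split; [exact: (df i).1|apply: IH; exact: (df i).2].
Qed.

Lemma Ck_subset k U U' f : U' `<=` U -> Ck k U f -> Ck k U' f.
Proof.
move=> U'U; elim: k f => [|k IH] f [cf df]; split => //.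
- by move=> x /U'U; exact: cf.
- by move=> x /U'U; exact: cf.
- move=> i; split; first by move=> x /U'U; exact: (df i).1.
  by apply: IH; exact: (df i).2.
Qed.

Lemma partial_eq U f g i x : open U -> {in U, f =1 g} -> U x ->
  partial i f x = partial i g x.
Proof.
move=> oU fg Ux; apply: near_eq_derive.
by near=> y; apply: fg; rewrite inE; near: y; exact: open_nbhs_nbhs.
Unshelve. all: by end_near. Qed.

Lemma eq_Ck k U f g : open U -> {in U, f =1 g} -> Ck k U f -> Ck k U g.
Proof.
move=> oU.
have near_fg (f' g' : E -> R) x : {in U, f' =1 g'} -> U x ->
    \forall y \near x, f' y = g' y.
  move=> fg Ux; near=> y; apply: fg; rewrite inE; near: y.
  exact: open_nbhs_nbhs.
have cong (f' g' : E -> R) x : {in U, f' =1 g'} -> U x ->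
    {for x, continuous f'} -> {for x, continuous g'}.
  move=> fg Ux cf; suff : g' @ x --> g' x by [].
  rewrite -(fg x) ?inE//.
  apply: cvg_trans cf; exact: (@near_eq_cvg _ _ (nbhs x) _ _ _ (near_fg f' g' x fg Ux)).
elim: k f g => [|k IH] f g fg [cf df]; split => //.
- by move=> x Ux; apply: (cong f g) => //; exact: cf.
- by move=> x Ux; apply: (cong f g) => //; exact: cf.
- move=> i; split.
    move=> x Ux; apply: near_eq_derivable ((df i).1 x Ux); exact: near_fg.
  apply: IH (df i).2 => x; rewrite inE => Ux; exact: (partial_eq i oU fg Ux).
Unshelve. all: by end_near. Qed.

Lemma Ck_cst k U (a : R) : Ck k U (fun=> a).
Proof.
elim: k a => [|k IH] a; split => //; try by move=> x _; exact: cst_continuous.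
move=> i; split; first by move=> x _; exact: derivable_cst.
suff -> : partial i (fun=> a) = fun=> 0 by exact: IH.
by apply/funext => x; exact: derive_cst.
Qed.

Lemma partialD k U f g i x : Ck k.+1 U f -> Ck k.+1 U g -> U x ->
  partial i (fun y => f y + g y) x = partial i f x + partial i g x.
Proof.
by move=> kf kg Ux; apply: deriveD; [exact: Ck_derivable kf Ux|
  exact: Ck_derivable kg Ux].
Qed.

Lemma partialM k U f g i x : Ck k.+1 U f -> Ck k.+1 U g -> U x ->
  partial i (fun y => f y * g y) x =
  partial i f x * g x + f x * partial i g x.
Proof.
move=> kf kg Ux; rewrite addrC [X in _ + X]mulrC; apply: deriveM.
  exact: Ck_derivable kf Ux.
exact: Ck_derivable kg Ux.
Qed.

Lemma CkD k U f g : open U -> Ck k U f -> Ck k U g ->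
  Ck k U (fun x => f x + g x).
Proof.
move=> oU.
have cfg k' f' g' x : Ck k' U f' -> Ck k' U g' -> U x ->
    {for x, continuous (fun x => f' x + g' x)}.
  move=> kf kg Ux.
  exact: continuousD (Ck_continuous kf Ux) (Ck_continuous kg Ux).
elim: k f g => [|k IH] f g kf kg; split => //; try by move=> x; exact: (cfg _ _ _ x kf kg).
move=> i; split.
  move=> x Ux; apply: derivableD; [exact: Ck_derivable kf Ux|
    exact: Ck_derivable kg Ux].
apply: eq_Ck (IH _ _ (Ck_partial i kf) (Ck_partial i kg)) => // x.
by rewrite inE => Ux; rewrite (partialD _ kf kg Ux).
Qed.

Lemma CkM k U f g : open U -> Ck k U f -> Ck k U g ->
  Ck k U (fun x => f x * g x).
Proof.
move=> oU.
have cfg k' f' g' x : Ck k' U f' -> Ck k' U g' -> U x ->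
    {for x, continuous (fun x => f' x * g' x)}.
  move=> kf kg Ux.
  exact: continuousM (Ck_continuous kf Ux) (Ck_continuous kg Ux).
elim: k f g => [|k IH] f g kf kg; split => //; try by move=> x; exact: (cfg _ _ _ x kf kg).
move=> i; split.
  move=> x Ux; apply: derivableM; [exact: Ck_derivable kf Ux|
    exact: Ck_derivable kg Ux].
apply: (@eq_Ck _ _ (fun x => partial i f x * g x + f x * partial i g x)) => //.
  by move=> x; rewrite inE => Ux; rewrite (partialM _ kf kg Ux).
apply: CkD => //; apply: IH; first [exact: Ck_partial|exact: Ck_pred].
Qed.

Lemma CkZ k U (a : R) f : open U -> Ck k U f -> Ck k U (fun x => a * f x).
Proof. by move=> oU; apply: CkM => //; exact: Ck_cst. Qed.

Lemma CkN k U f : open U -> Ck k U f -> Ck k U (fun x => - f x).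
Proof.
move=> oU /(CkZ (-1) oU); apply: eq_Ck => // x _.
by rewrite mulN1r.
Qed.

Lemma CkB k U f g : open U -> Ck k U f -> Ck k U g ->
  Ck k U (fun x => f x - g x).
Proof. by move=> oU kf kg; apply: CkD => //; exact: CkN. Qed.

Lemma Ck_sum k U (I : Type) (r : seq I) (F : I -> E -> R) : open U ->
  (forall j, Ck k U (F j)) -> Ck k U (fun x => \sum_(j <- r) F j x).
Proof.
move=> oU kF; elim: r => [|j r IH].
  by under [fun _ => _]eq_fun do rewrite big_nil; exact: Ck_cst.
by under [fun _ => _]eq_fun do rewrite big_cons; exact: CkD.
Qed.

Lemma partial_sum k U (I : Type) (r : seq I) (F : I -> E -> R) i x : open U ->
  (forall j, Ck k.+1 U (F j)) -> U x ->
  partial i (fun y => \sum_(j <- r) F j y) x =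
  \sum_(j <- r) partial i (F j) x.
Proof.
move=> oU kF Ux; elim: r => [|j r IH].
  under [fun _ => _]eq_fun do rewrite big_nil.
  by rewrite big_nil; exact: derive_cst.
under [fun _ => _]eq_fun do rewrite big_cons.
by rewrite big_cons (partialD _ (kF j) (Ck_sum r oU kF) Ux) IH.
Qed.

(** Postcomposition with a function of one variable that comes with all its
    derivatives, [h n.+1] being the derivative of [h n]. *)
Lemma Ck_comp k U (h : nat -> R -> R) (n : nat) f : open U ->
  (forall m (s : R), is_derive s 1 (h m) (h m.+1 s)) ->
  Ck k U f -> Ck k U (h n \o f).
Proof.
move=> oU hh.
have cont m f' x : {for x, continuous f'} -> {for x, continuous (h m \o f')}.
  move=> cf; apply: continuous_comp => //.
  have d : derivable (h m) (f' x) 1 by exact: ex_derive.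
  exact/differentiable_continuous/derivable1_diffP.
elim: k n f => [|k IH] n f kf; split => //;
  try by move=> x Ux; apply: cont; exact: Ck_continuous kf Ux.
have der i x : U x -> is_derive x (delta_mx 0 i) (h n \o f)
    (h n.+1 (f x) * partial i f x).
  move=> Ux; apply: is_derive_chain (hh n (f x)) _.
  exact: Ck_is_derive kf Ux.
move=> i; split; first by move=> x Ux; have [] := der i x Ux.
apply: (@eq_Ck _ _ (fun x => (h n.+1 \o f) x * partial i f x)) => //.
  by move=> x; rewrite inE => Ux; have [_ <-] := der i x Ux.
by apply: CkM => //; [apply: IH; exact: Ck_pred|exact: Ck_partial].
Qed.

Lemma CkV k U f : open U -> (forall x, U x -> f x != 0) ->
  Ck k U f -> Ck k U (fun x => (f x)^-1).
Proof.
move=> oU f0; elim: k f f0 => [|k IH] f f0 kf; split => //;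
  try by move=> x Ux; exact: continuousV (f0 _ Ux) (Ck_continuous kf Ux).
move=> i; split.
  by move=> x Ux; apply: derivableV; [exact: f0|exact: Ck_derivable kf Ux].
apply: (@eq_Ck _ _ (fun x => - ((f x)^-1 * (f x)^-1 * partial i f x))) => //.
  move=> x; rewrite inE => Ux; rewrite /partial deriveV ?f0//.
    by rewrite scaleNr expr2 invfM.
  exact: Ck_derivable kf Ux.
apply: CkN => //; apply: CkM => //; last exact: Ck_partial.
by apply: CkM => //; apply: IH => //; exact: Ck_pred.
Qed.

Lemma Ck_coord k U i : Ck k U (fun x => x 0 i).
Proof.
have der j (x : E) : is_derive x (delta_mx 0 j) (fun y : E => y 0 i)
    ((delta_mx 0 j : E) 0 i).
  apply/is_derive_line0.
  set c := (delta_mx 0 j : E) 0 i.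
  have -> : (fun h : R => (h *: (delta_mx 0 j : E) + x) 0 i) =
      (c \*: (@idfun R) + cst (x 0 i)).
    by apply/funext => h; rewrite mxE [X in X + _]mxE mulrC.
  have : is_derive (0 : R) (1 : R) (c \*: (@idfun R) + cst (x 0 i))
      (c *: (1 : R) + 0) by exact: is_deriveD.
  by rewrite addr0 [_ *: 1]mulr1.
case: k => [|k]; split => //; try by move=> x _; exact: coord_continuous.
move=> j; split; first by move=> x _; have [] := der j x.
have -> : partial j (fun y : E => y 0 i) = fun=> (delta_mx 0 j : E) 0 i.
  by apply/funext => x; have [_] := der j x.
exact: Ck_cst.
Qed.

Lemma smooth_partial U f i : smooth U f -> smooth U (partial i f).
Proof. by move=> sf k; exact/Ck_partial/sf. Qed.

Lemma smoothM U f g : open U -> smooth U f -> smooth U g ->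
  smooth U (fun x => f x * g x).
Proof. by move=> oU sf sg k; apply: CkM. Qed.

Lemma smooth_sum U (I : Type) (r : seq I) (F : I -> E -> R) : open U ->
  (forall j, smooth U (F j)) -> smooth U (fun x => \sum_(j <- r) F j x).
Proof. by move=> oU sF k; apply: Ck_sum => // j; exact: sF. Qed.

Lemma smoothV U f : open U -> (forall x, U x -> f x != 0) -> smooth U f ->
  smooth U (fun x => (f x)^-1).
Proof. by move=> oU f0 sf k; exact: CkV. Qed.

End Ck_theory.

(** * Second-order test at an interior maximum *)

Section directional.
Context {R : realType} {N : nat}.
Local Notation E := 'rV[R]_N.
Implicit Types (U : set E) (f g : E -> R) (k : nat) (i : 'I_N).

(** The endpoints are unordered, since an increment along an axis may be
    negative. *)
Lemma MVT_from0 (f df : R -> R) (b : R) :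
  (forall s : R, `|s| <= `|b| -> is_derive s 1 f (df s)) ->
  exists2 c, `|c| <= `|b| & f b - f 0 = df c * b.
Proof.
move=> dfs.
have cf (i : interval R) : {subset i <= [pred s | `|s| <= `|b|]} ->
    {within [set` i], continuous f}.
  move=> si; apply: derivable_within_continuous => s /si sb.
  by apply: ex_derive; exact: dfs.
have [b0|b0] := leP 0 b.
  have sub : {subset `[0, b]%R <= [pred s | `|s| <= `|b|]}.
    move=> s; rewrite in_itv/= => /andP[s0 sb].
    by rewrite inE/= !ger0_norm.
  have [|c c0b ->] := @MVT_segment R f df 0 b b0 _ (cf _ sub).
    by move=> s /subset_itv_oo_cc /sub; exact: dfs.
  by exists c; [exact: sub|rewrite subr0].
have sub : {subset `[b, 0]%R <= [pred s | `|s| <= `|b|]}.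
  move=> s; rewrite in_itv/= => /andP[sb s0].
  by rewrite inE/= !ler0_norm ?lerN2// ltW.
have [|c cb0 e] := @MVT_segment R f df b 0 (ltW b0) _ (cf _ sub).
  by move=> s /subset_itv_oo_cc /sub; exact: dfs.
by exists c; [exact: sub|rewrite -opprB e sub0r mulrN opprK].
Qed.

(** Moving first along [w] and then along the [i]-th axis: the mean value theorem
    turns the second increment into a value of the partial derivative, whose
    continuity absorbs the moving base point. *)
Lemma is_derive_add_axis U f x (w : E) i (a dw : R) : open U -> Ck 1 U f ->
  U x -> is_derive x w f dw ->
  is_derive x (w + a *: delta_mx 0 i) f (dw + a * partial i f x).
Proof.
move=> oU kf Ux [dfw <-].
set e := delta_mx 0 i.
suff H : (fun h : R => h^-1 *: (f (h *: (w + a *: e) + x) - f (h *: w + x)))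
    @ 0^' --> a * partial i f x.
  have C : (fun h : R => h^-1 *: (f (h *: (w + a *: e) + x) - f x))
      @ 0^' --> 'D_w f x + a * partial i f x.
    rewrite (_ : (fun h : R => _) =
        (fun h : R => h^-1 *: (f (h *: w + x) - f x)) +
        (fun h : R => h^-1 *: (f (h *: (w + a *: e) + x) - f (h *: w + x)))).
      by apply: cvgD => //; exact: dfw.
    apply/funext => h; rewrite fctE -scalerDr; congr (_ *: _); ring.
  by apply: DeriveDef; [apply/cvg_ex; eexists; exact: C|exact: cvg_lim C].
have cd : {for x, continuous (partial i f)}.
  exact: Ck_continuous (Ck_partial i kf) Ux.
apply/cvgrPdist_le => eps eps0.
pose eps' := eps / (`|a| + 1).
have a1 : 0 < `|a| + 1 by rewrite ltr_wpDl.
have eps'0 : 0 < eps' by rewrite divr_gt0.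
have : \forall y \near x, U y /\ `|partial i f x - partial i f y| <= eps'.
  near=> y; split; first by near: y; exact: open_nbhs_nbhs.
  by near: y; move/cvgrPdist_le : cd; exact.
move=> /nbhs_ballP[d /= d0 xd].
(* [`|h| * M] bounds the length of both moves, from [x] along [w] and then along
   [e]. *)
pose M := `|w| + `|a| * `|e| + 1.
have M0 : 0 < M by rewrite ltr_wpDl// addr_ge0// mulr_ge0.
have dM0 : 0 < d / M by rewrite divr_gt0.
near=> h.
have h0 : h != 0 by near: h; exact: nbhs_dnbhs_neq.
have hd : `|h| < d / M.
  near: h; apply: dnbhs0_lt; exact: dM0.
have hball (s : R) : `|s| <= `|h * a| -> ball x d (s *: e + (h *: w + x)).
  move=> sh; rewrite -ball_normE /ball_/=.
  rewrite distrC addrA addrK (le_lt_trans (ler_normD _ _))// !normrZ.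
  apply: (@le_lt_trans _ _ (`|h| * M)); last by rewrite -ltr_pdivlMr.
  rewrite /M mulrDr mulrDr mulr1 addrC -addrA lerD2l.
  rewrite ler_wpDr// mulrA -normrM.
  exact: ler_wpM2r.
have [s sh Hs] := @MVT_from0 (fun s => f (s *: e + (h *: w + x)))
    (fun s => partial i f (s *: e + (h *: w + x))) (h * a)
  (fun s sh => (is_derive_line _ _ _ _ _).1
     (Ck_is_derive i kf (xd _ (hball s sh)).1)).
have [_ Hd] := xd _ (hball s sh).
have -> : h *: (w + a *: e) + x = (h * a) *: e + (h *: w + x).
  by rewrite scalerDr scalerA addrA [X in X + x]addrC.
move: Hs; rewrite scale0r add0r => ->.
rewrite [X in `|_ - X|](_ : _ = a * partial i f (s *: e + (h *: w + x))); last first.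
  by rewrite [LHS]mulrCA mulKf// mulrC.
rewrite -mulrBr normrM.
apply: le_trans (ler_wpM2l (normr_ge0 a) Hd) _.
rewrite /eps' mulrCA ger_pMr// ler_pdivrMr// mul1r.
by rewrite lerDl.
Unshelve. all: by end_near. Qed.

(** Continuous partial derivatives determine all directional derivatives: the
    direction is reached by one coordinate move after the other. *)
Lemma is_derive_Ck1 U f x (v : E) : open U -> Ck 1 U f -> U x ->
  is_derive x v f (\sum_i v 0 i * partial i f x).
Proof.
move=> oU kf Ux; rewrite {1}[v]row_sum_delta.
elim: (index_enum _) => [|i r IH].
  by rewrite !big_nil; exact: is_derive0.
by rewrite !big_cons addrC [X in is_derive _ _ _ X]addrC;
  exact: is_derive_add_axis Ux IH.
Qed.

Lemma partial_max U f x i : open U -> Ck 1 U f -> U x ->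
  (forall y, U y -> f y <= f x) -> partial i f x = 0.
Proof.
move=> oU kf Ux fmax; set e := delta_mx 0 i : E.
have /nbhs_ballP[d /= d0 xd] : nbhs x U by exact: open_nbhs_nbhs.
pose b := d / (`|e| + 1).
have e1 : 0 < `|e| + 1 by rewrite ltr_wpDl.
have b0 : 0 < b by rewrite divr_gt0.
have sU (s : R) : s \in `](- b), b[%R -> U (s *: e + x).
  rewrite in_itv /= -ltr_norml => sb; apply: xd.
  rewrite -ball_normE /ball_/= distrC addrK normrZ.
  apply: (@le_lt_trans _ _ (`|s| * (`|e| + 1))).
    by rewrite ler_wpM2l// lerDl.
  by rewrite -ltr_pdivlMr.
have z : 0 \in `](- b), b[%R by rewrite in_itv/= oppr_lt0 b0.
have := @derive1_at_max _ (fun s => f (s *: e + x)) (- b) b 0.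
case=> //; first by rewrite ge0_cp// ltW.
- move=> s /sU Us.
  by have /is_derive_line[] := Ck_is_derive i kf Us.
- by move=> s /sU Us; rewrite scale0r add0r; exact: fmax.
have /is_derive_line0[_] := Ck_is_derive i kf Ux.
by move=> -> _.
Qed.

(** If the second derivative [q] along [v] were positive, the first derivative
    [D] along [v] would be positive just after [x], and the function would
    increase. *)
Lemma hessian_max U f x (v : E) : open U -> Ck 2 U f -> U x ->
  (forall y, U y -> f y <= f x) ->
  \sum_i \sum_j v 0 i * v 0 j * partial i (partial j f) x <= 0.
Proof.
move=> oU kf Ux fmax.
have kf1 := Ck_pred kf.
have /nbhs_ballP[d /= d0 xd] : nbhs x U by exact: open_nbhs_nbhs.
pose b := d / (`|v| + 1).
have e1 : 0 < `|v| + 1 by rewrite ltr_wpDl.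
have b0 : 0 < b by rewrite divr_gt0.
have sU (s : R) : `|s| < b -> U (s *: v + x).
  move=> sb; apply: xd.
  rewrite -ball_normE /ball_/= distrC addrK normrZ.
  apply: (@le_lt_trans _ _ (`|s| * (`|v| + 1))).
    by rewrite ler_wpM2l// lerDl.
  by rewrite -ltr_pdivlMr.
pose D y := \sum_j v 0 j * partial j f y.
have D1 : Ck 1 U D.
  by apply: (Ck_sum _ oU) => j; exact: (CkZ (v 0 j) oU (Ck_partial j kf)).
have Dx0 : D x = 0.
  rewrite /D big1// => j _.
  by rewrite (partial_max j oU kf1 Ux fmax) mulr0.
have := is_derive_Ck1 v oU D1 Ux.
rewrite [X in is_derive _ _ _ X](_ : _ =
    \sum_i \sum_j v 0 i * v 0 j * partial i (partial j f) x); last first.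
  apply: eq_bigr => i _; rewrite /D.
  have kvf j := CkZ (v 0 j) oU (Ck_partial j kf).
  rewrite (partial_sum _ i oU kvf Ux) mulr_sumr; apply: eq_bigr => j _.
  rewrite (partialM i (Ck_cst 1 U (v 0 j)) (Ck_partial j kf) Ux).
  by rewrite {1}/partial derive_cst mul0r add0r mulrA.
set q := \sum_i _ => -[dD Dq].
rewrite leNgt; apply/negP => q0.
have : (fun h : R => h^-1 *: (D (h *: v + x) - D x)) @ 0^' --> q.
  by rewrite -Dq; exact: dD.
move=> /cvgrPdist_lt /(_ q q0) /nbhs_ballP[r /= r0 rq].
pose s := Num.min (b / 2) (r / 2).
have s0 : 0 < s by rewrite lt_min !divr_gt0.
have sb : `|s| < b.
  rewrite gtr0_norm// (@le_lt_trans _ _ (b / 2)) ?ge_min ?lexx//.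
  by rewrite ltr_pdivrMr// ltr_pMr// ltr1n.
have sr : s < r.
  rewrite (@le_lt_trans _ _ (r / 2)) ?ge_min ?lexx ?orbT//.
  by rewrite ltr_pdivrMr// ltr_pMr// ltr1n.
have der (t : R) : `|t| < b -> is_derive t 1 (fun s => f (s *: v + x)) (D (t *: v + x)).
  move=> tb; apply: (is_derive_line f x v t _).1.
  exact: (is_derive_Ck1 v oU kf1 (sU _ tb)).
have cs : {within `[0, s], continuous (fun s => f (s *: v + x))}.
  apply: derivable_within_continuous => t; rewrite in_itv/= => /andP[t0 ts].
  apply: ex_derive; apply: der; rewrite ger0_norm//.
  by rewrite (le_lt_trans ts)// -(gtr0_norm s0).
have [|t] := @MVT R (fun s => f (s *: v + x)) (fun t => D (t *: v + x)) 0 s s0 _ cs.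
  move=> t; rewrite in_itv/= => /andP[t0 ts].
  by apply: der; rewrite gtr0_norm// (lt_trans ts)// -(gtr0_norm s0).
rewrite in_itv/= => /andP[t0 ts]; rewrite scale0r add0r subr0 => ft.
have Dt : 0 < D (t *: v + x).
  have := rq t; rewrite -ball_normE /ball_ /= sub0r normrN gtr0_norm//.
  move=> /(_ (lt_trans ts sr)); rewrite gt_eqF// => /(_ isT).
  rewrite Dx0 subr0 ltr_norml => /andP[_ h].
  suff : 0 < D (t *: v + x) * t^-1 by rewrite pmulr_lgt0 ?invr_gt0.
  by move: h; rewrite [_ *: _]mulrC; lra.
have : 0 < f (s *: v + x) - f x by rewrite ft mulr_gt0.
by rewrite subr_gt0 ltNge fmax//; exact: sU.
Qed.

End directional.

Section psd_matrices.
Context {R : realType} {N : nat}.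
Implicit Types (M : 'M[R]_N) (u v w : 'rV[R]_N).

Definition mxform M u w : R := (u *m M *m w^T) 0 0.

Lemma mxformE M u w : mxform M u w = \sum_i \sum_j u 0 i * M i j * w 0 j.
Proof.
rewrite /mxform mxE exchange_big /=; apply: eq_bigr => j _.
by rewrite !mxE mulr_suml.
Qed.

Lemma mxformDZ M u w (t : R) : M^T = M ->
  mxform M (u + t *: w) (u + t *: w) =
  mxform M u u + t * mxform M w u *+ 2 + t ^+ 2 * mxform M w w.
Proof.
move=> symM; have symB : mxform M u w = mxform M w u.
  rewrite !mxformE exchange_big /=; apply: eq_bigr => i _.
  by apply: eq_bigr => j _; rewrite -[in RHS]symM mxE; ring.
have E (a b c : 'rV[R]_N) (s : R) :
    mxform M (a + s *: b) c = mxform M a c + s * mxform M b c.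
  by rewrite /mxform mulmxDl mulmxDl -!scalemxAl !mxE.
have E' (a b c : 'rV[R]_N) (s : R) :
    mxform M c (a + s *: b) = mxform M c a + s * mxform M c b.
  by rewrite /mxform linearD linearZ /= mulmxDr -scalemxAr !mxE.
rewrite E !E' symB; ring.
Qed.

(** Otherwise the form would be an affine nonconstant function of [t] along
    [u + t *: w]; the witness is a [t] where it equals [-1]. *)
Lemma psd_isotropic M u w : M^T = M -> psd_mx M -> mxform M w w = 0 ->
  mxform M w u = 0.
Proof.
move=> symM psdM ww; apply/eqP; apply: contraT => wu.
have := psdM (u + (- (mxform M u u + 1) / (mxform M w u *+ 2)) *: w).
rewrite -/(mxform M _ _) mxformDZ// ww mulr0 addr0.
set a := mxform M u u; set b := mxform M w u in wu *.
have -> : - (a + 1) / (b *+ 2) * b *+ 2 = - (a + 1) by field.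
by lra.
Qed.

Lemma mxform_delta M i u : mxform M (delta_mx 0 i) u = \sum_j M i j * u 0 j.
Proof. by rewrite /mxform -rowE mxE; apply: eq_bigr => j _; rewrite !mxE. Qed.

Lemma mxform_delta2 M i j : mxform M (delta_mx 0 i) (delta_mx 0 j) = M i j.
Proof.
rewrite mxform_delta (bigD1 j)//= mxE !eqxx mulr1 big1 ?addr0// => k kj.
by rewrite mxE (negbTE kj) andbF mulr0.
Qed.

(** Symmetric Gaussian elimination: subtracting the square of a rescaled row kills
    one diagonal entry, keeps the matrix positive semidefinite, and creates no
    new nonzero diagonal entry. *)
Lemma psd_sum_squares M : M^T = M -> psd_mx M ->
  exists vs : seq 'rV[R]_N,
    forall i j, M i j = \sum_(v <- vs) v 0 i * v 0 j.
Proof.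
have [n] := ubnP #|[pred i | M i i != 0]|.
elim: n M => [//|n IH] M cn symM psdM.
have Mij0 i j : M i i = 0 -> M i j = 0.
  by move=> Mi; rewrite -mxform_delta2 psd_isotropic// mxform_delta2.
have [i Mii|M0] := pickP (fun i => M i i != 0); last first.
  exists [::] => i j; rewrite big_nil; apply: Mij0; apply/eqP.
  by have := M0 i; case: eqP.
have Mpos : 0 < M i i.
  rewrite lt_neqAle eq_sym Mii/= -mxform_delta2; exact: psdM.
pose v : 'rV[R]_N := \row_j (M i j / Num.sqrt (M i i)).
have vv j k : v 0 j * v 0 k = M i j * M i k / M i i.
  rewrite !mxE mulrACA -invfM -expr2 sqr_sqrtr//; exact: ltW.
pose M' := M - v^T *m v.
have M'E j k : M' j k = M j k - M i j * M i k / M i i.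
  by rewrite !mxE big_ord1 mxE vv.
have symM' : M'^T = M'.
  apply/matrixP => j k; rewrite mxE !M'E [M i k * _]mulrC.
  by congr (_ - _); rewrite -[in LHS]symM mxE.
have psdM' : psd_mx M'.
  move=> w; rewrite -/(mxform M' w w).
  pose b := mxform M (delta_mx 0 i) w.
  have -> : mxform M' w w = mxform M w w - b ^+ 2 / M i i.
    rewrite /b mxform_delta expr2 big_distrlr /= !mxformE mulr_suml -sumrB.
    apply: eq_bigr => j _; rewrite mulr_suml -sumrB; apply: eq_bigr => k _.
    by rewrite M'E; ring.
  (* The minimum of the form over the line [w + t *: delta_mx 0 i]. *)
  have := psdM (w + (- b / M i i) *: delta_mx 0 i).
  rewrite -/(mxform M _ _) mxformDZ// mxform_delta2 -/b.
  suff -> : mxform M w w + - b / M i i * b *+ 2 + (- b / M i i) ^+ 2 * M i i =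
    mxform M w w - b ^+ 2 / M i i by [].
  by field; rewrite gt_eqF.
have [|//|//|vs vsE] := IH M'.
  rewrite -ltnS; apply: leq_trans cn; rewrite ltnS; apply: proper_card.
  apply/properP; split.
    apply/fintype.subsetP => j; rewrite !inE; apply: contraNneq => Mj.
    have ij : M i j = 0 by rewrite -symM mxE Mij0.
    by rewrite M'E Mj ij mul0r mul0r subrr.
  exists i; first by rewrite inE.
  by rewrite inE M'E negbK mulfK// subrr.
exists (v :: vs) => j k; rewrite big_cons -vsE M'E vv; ring.
Qed.

End psd_matrices.

Section degenerate_ellipticity.
Context {R : realType} {N : nat}.
Local Notation E := 'rV[R]_N.

(** At an interior maximum the gradient vanishes, so only the trace of [A] times
    the Hessian survives; it is a sum of second derivatives along the vectors
    whose squares add up to [A x]. *)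
Lemma div_op_max (V : E -> R) (A : E -> 'M[R]_N) (U : set E) w x :
  smooth setT V -> (forall y, 0 < V y) ->
  (forall i j, smooth setT (fun y => A y i j)) ->
  (A x)^T = A x -> psd_mx (A x) ->
  open U -> Ck 2 U w -> U x -> (forall y, U y -> w y <= w x) ->
  div_op V A w x <= 0.
Proof.
move=> sV V0 sA symA psdA oU kw Ux wmax.
have kw1 := Ck_pred kw.
have kVA i j : Ck 1 U (fun y => V y * A y i j).
  apply: (CkM oU); first exact: (Ck_subset (@subsetT _ U) (sV 1%N)).
  exact: (Ck_subset (@subsetT _ U) (sA i j 1%N)).
rewrite /div_op.
have -> : \sum_i \sum_j partial i (fun y => V y * A y i j * partial j w y) x =
    V x * \sum_i \sum_j A x i j * partial i (partial j w) x.
  rewrite mulr_sumr; apply: eq_bigr => i _.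
  rewrite mulr_sumr; apply: eq_bigr => j _.
  rewrite (partialM i (kVA i j) (Ck_partial j kw) Ux).
  by rewrite (partial_max j oU kw1 Ux wmax) mulr0 add0r mulrA.
rewrite mulKf ?gt_eqF//.
have [vs vsE] := psd_sum_squares symA psdA.
under eq_bigr do under eq_bigr do rewrite vsE mulr_suml.
under eq_bigr do rewrite exchange_big.
rewrite exchange_big /=.
rewrite -oppr_ge0 -sumrN; apply: sumr_ge0 => v _.
by rewrite oppr_ge0; exact: (hessian_max v oU kw Ux wmax).
Qed.

End degenerate_ellipticity.

(** * Bump functions *)

Section flat.
Context {R : realType}.
Implicit Types (p : {poly R}).

Lemma horner_le_expR p : exists2 C, 0 <= C &
  forall y : R, 0 <= y -> `|p.[y]| <= C * expR y.
Proof.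
have mono n (y : R) : 0 <= y -> y ^+ n <= n`!%:R * expR y.
  move=> y0; case: n => [|n].
    by rewrite expr0 fact0 mul1r (le_trans _ (expR_ge1Dx y))// lerDl.
  rewrite mulrC -ler_pdivrMr ?ltr0n ?fact_gt0//.
  by apply: le_trans (expR_ge1Dxn n y0); rewrite lerDr.
exists (\sum_(i < size p) `|p`_i| * i`!%:R).
  by apply: sumr_ge0 => i _; rewrite mulr_ge0.
move=> y y0; rewrite horner_coef mulr_suml.
apply: le_trans (ler_norm_sum _ _ _) _; apply: ler_sum => i _.
rewrite normrM -mulrA ler_wpM2l// normrX ger0_norm//; exact: mono.
Qed.

(** The functions [p(1/s) exp(-1/s)], extended by 0 to [s <= 0], are permuted by
    differentiation. *)
Definition flat p (s : R) : R :=
  if 0 < s then p.[s^-1] * expR (- s^-1) else 0.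

(** At 0 the derivative vanishes because [exp (-1/s)] beats every power of
    [1/s]. *)
Lemma is_derive_flat p (s : R) :
  is_derive s 1 (flat p) (flat ('X^2 * (p - p^`())) s).
Proof.
have [s0|s0|->] := ltgtP s 0.
- rewrite {2}/flat ltNge ltW//=.
  apply: (@near_eq_is_derive _ _ _ (cst 0)).
    near=> t; rewrite /flat ltNge ltW//=; near: t; exact: lt_nbhsl.
- rewrite {2}/flat s0.
  apply: (@near_eq_is_derive _ _ _
      ((horner p \o (fun t : R => t^-1)) * (expR \o (fun t : R => - t^-1)))).
    near=> t; rewrite /flat ifT//; near: t; exact: lt_nbhsr.
  have dV : is_derive s 1 (fun t : R => t^-1) (- s ^- 2).
    have sn0 : id s != 0 by rewrite gt_eqF.
    have did : derivable (@id R) s 1 by exact: derivable_id.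
    apply: DeriveDef; first exact: derivableV sn0 did.
    by rewrite (deriveV sn0 did) derive_id [_ *: 1]mulr1.
  have dp : is_derive s 1 (horner p \o (fun t : R => t^-1))
      (p^`().[s^-1] * - s ^- 2).
    by apply: is_derive_chain => //; exact: is_derive_poly.
  have dVN : is_derive s 1 (fun t : R => - t^-1) (- - s ^- 2).
    exact: is_deriveN.
  have de : is_derive s 1 (expR \o (fun t : R => - t^-1))
      (expR (- s^-1) * - - s ^- 2).
    by apply: is_derive_chain => //; exact: is_derive_expR.
  have -> : ('X^2 * (p - p^`())).[s^-1] * expR (- s^-1) =
      (horner p \o (fun t : R => t^-1)) s *: (expR (- s^-1) * - - s ^- 2) +
      (expR \o (fun t : R => - t^-1)) s *: (p^`().[s^-1] * - s ^- 2).
    rewrite !hornerE /= /GRing.scale /= exprVn; ring.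
  exact: is_deriveM.
- rewrite {2}/flat ltxx.
  have [C C0 pC] := horner_le_expR ('X^2 * p).
  have flatC (h : R) : `|flat p h| <= C * h ^+ 2.
    rewrite /flat; case: ifPn => h0; last by rewrite normr0 mulr_ge0// sqr_ge0.
    rewrite normrM [X in _ * X]ger0_norm ?expR_ge0// expRN.
    rewrite ler_pdivrMr ?expR_gt0// mulrAC -ler_pdivrMr ?exprn_gt0//.
    have hV0 : 0 <= h^-1 by rewrite invr_ge0 ltW.
    apply: le_trans _ (pC h^-1 hV0).
    rewrite hornerM hornerXn normrM [`|h^-1 ^+ 2|]ger0_norm ?sqr_ge0//.
    by rewrite mulrC exprVn.
  have cv : (fun h : R => h^-1 *: ((flat p \o shift 0) (h *: 1) - flat p 0))
      @ 0^' --> (0 : R).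
    apply/cvgr0Pnorm_le => e e0.
    have C1 : 0 < C + 1 by rewrite ltr_wpDl.
    near=> h.
    have h0 : h != 0 by near: h; exact: nbhs_dnbhs_neq.
    have he : `|h| < e / (C + 1).
      by near: h; apply: dnbhs0_lt; rewrite divr_gt0.
    rewrite /= addr0 [h *: 1]mulr1 {2}/flat ltxx subr0 normrZ normfV.
    rewrite ler_pdivrMl ?normr_gt0//; apply: le_trans (flatC h) _.
    rewrite -real_normK ?num_real// expr2 mulrCA ler_wpM2l//.
    rewrite ltr_pdivlMr// in he; apply: le_trans (ltW he).
    by rewrite mulrC ler_wpM2l// lerDl.
  by apply: DeriveDef; [apply/cvg_ex; exists 0|exact: cvg_lim cv].
Unshelve. all: by end_near. Qed.

End flat.

Section bump.
Context {R : realType} {N : nat}.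
Local Notation E := 'rV[R]_N.

Lemma compact_closed_ball (a : E) (d : R) : compact (closed_ball_ Num.norm a d).
Proof.
apply: bounded_closed_compact; last exact: closed_closed_ball_.
exists (`|a| + d); split; first exact: num_real.
move=> M ltM y /= ay; apply: le_trans (ltW ltM).
by rewrite -{1}[y](subKr a) (le_trans (ler_normB _ _))// lerD2l.
Qed.

Definition sqdist (a x : E) : R := \sum_i (x 0 i - a 0 i) ^+ 2.

(** [flat 1 s] is [exp (-1/s)] for positive [s]. *)
Definition bump (a : E) (d : R) (x : E) : R := flat 1 (d ^+ 2 - sqdist a x).

Lemma bump_ge0 a d x : 0 <= bump a d x.
Proof.
by rewrite /bump /flat; case: ifP => // _; rewrite hornerC mul1r expR_ge0.
Qed.

Lemma bump_gt0 a d x : sqdist a x < d ^+ 2 -> 0 < bump a d x.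
Proof.
by move=> ad; rewrite /bump /flat subr_gt0 ad hornerC mul1r expR_gt0.
Qed.

Lemma sqdistxx a : sqdist a a = 0.
Proof. by rewrite /sqdist big1// => i _; rewrite subrr expr0n. Qed.

Lemma norm_rV_ltP (x : E) (d : R) : 0 < d ->
  (forall i, `|x 0 i| < d) -> `|x| < d.
Proof.
move=> d0 xd; rewrite [`|x|]mx_normrE; apply/bigmax_ltP; split => // -[i j] _ /=.
by rewrite ord1.
Qed.

Lemma le_coord_norm (x : E) i : `|x 0 i| <= `|x|.
Proof.
rewrite [`|x|]mx_normrE.
by apply/bigmax_geP; right; exists (0, i).
Qed.

Lemma bump_eq0 a d x : 0 < d -> d <= `|x - a| -> bump a d x = 0.
Proof.
move=> d0 dx; rewrite /bump /flat subr_gt0 ifF//; apply/negbTE; rewrite -leNgt.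
have [i dxi] : exists i, d <= `|x 0 i - a 0 i|.
  apply/not_existsP => h; move: dx; apply/negP; rewrite -ltNge.
  apply: norm_rV_ltP => // i; rewrite !mxE ltNge; apply/negP; exact: h.
apply: (@le_trans _ _ ((x 0 i - a 0 i) ^+ 2)).
  by rewrite -[leRHS]real_normK ?num_real// lerXn2r ?nnegrE// ltW.
by rewrite /sqdist (bigD1 i)//= lerDl sumr_ge0// => j _; exact: sqr_ge0.
Qed.

Lemma smooth_bump a d : smooth setT (bump a d).
Proof.
have sm i : smooth setT (fun x : E => x 0 i - a 0 i).
  by move=> k; apply: CkB; [exact: openT|exact: Ck_coord|exact: Ck_cst].
pose h n := flat (iter n (fun p : {poly R} => 'X^2 * (p - p^`())) 1).
have -> : bump a d = h 0%N \o (fun x => d ^+ 2 - sqdist a x) by [].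
move=> k; apply: Ck_comp; first exact: openT.
- by move=> m s; exact: is_derive_flat.
- apply: CkB; [exact: openT|exact: Ck_cst|].
  apply: Ck_sum; first exact: openT.
  move=> i; under eq_fun do rewrite expr2.
  by apply: CkM; [exact: openT|exact: sm|exact: sm].
Qed.

Lemma test_function_bump (U : set E) a d : 0 < d ->
  closed_ball_ Num.norm a d `<=` U -> test_function U (bump a d).
Proof.
move=> d0 aU; split; first exact: smooth_bump.
exists (closed_ball_ Num.norm a d); split=> //; first exact: compact_closed_ball.
move=> x /= /negP; rewrite -ltNge => dx; apply: bump_eq0 => //.
by rewrite distrC ltW.
Qed.

End bump.

(** * Lebesgue integration over row vectors *)

Section row_integration.
Context {R : realType} {N : nat}.
Local Notation E := 'rV[R]_N.
Local Notation T := (N.-tuple (measurableTypeR R)).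
Local Notation row := (@row_of_tuple R N).
Implicit Types (f g : E -> R).

Definition coord_box (A : 'I_N -> set (measurableTypeR R)) : set T :=
  [set t | forall i, A i (tnth t i)].

Lemma measurable_coord_box (A : 'I_N -> set (measurableTypeR R)) :
  (forall i, measurable (A i)) -> measurable (coord_box A).
Proof.
move=> mA; rewrite [X in measurable X](_ : _ = \bigcap_(i in [set: 'I_N])
    ((@tnth N (measurableTypeR R) ^~ i) @^-1` A i)).
  apply: fin_bigcap_measurable; first exact: finite_finset.
  by move=> i _; rewrite -[X in measurable X]setTI; exact: measurable_tnth.
by apply/seteqP; split=> t /= h i; [move=> _; exact: h|exact: h].
Qed.

(** An open set is the countable union of the rational boxes that it contains.
    *)
Lemma measurable_row_open (O : set E) : open O -> measurable (row @^-1` O).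
Proof.
move=> oO.
pose A (c : {ffun 'I_N -> rat * rat}) i : set (measurableTypeR R) :=
  `](ratr (c i).1 : R), (ratr (c i).2 : R)[%classic.
pose B (c : {ffun 'I_N -> rat * rat}) : set T := coord_box (A c).
have mB c : measurable (B c).
  by apply: measurable_coord_box => i; exact: measurable_itv.
pose F (k : nat) : set T := if unpickle k is Some c then
  (if `[< B c `<=` row @^-1` O >] then B c else set0) else set0.
rewrite (_ : row @^-1` O = \bigcup_k F k).
  apply: bigcupT_measurable => k; rewrite /F.
  by case: unpickle => [c|]; [case: ifP|].
apply/seteqP; split=> t /=; last first.
  move=> [k _]; rewrite /F; case: unpickle => [c|//].
  by case: asboolP => // BO /BO.
move=> Ot.
have /nbhs_ballP[d /= d0 dO] : nbhs (row t) O by exact: open_nbhs_nbhs.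
have lo i : exists q : rat, tnth t i - d < ratr q < tnth t i.
  have [q] : exists q : rat, ratr q \in `](tnth t i - d), (tnth t i)[.
    by apply: rat_in_itvoo; rewrite ltrBlDr ltrDl.
  by rewrite in_itv/=; exists q.
have hi i : exists q : rat, tnth t i < ratr q < tnth t i + d.
  have [q] : exists q : rat, ratr q \in `](tnth t i), (tnth t i + d)[.
    by apply: rat_in_itvoo; rewrite ltrDl.
  by rewrite in_itv/=; exists q.
have [l hl] := choice lo; have [u hu] := choice hi.
pose c := [ffun i => (l i, u i)].
exists (pickle c) => //; rewrite /F pickleK.
have Bct : B c t.
  move=> i; rewrite /A /= in_itv/= ffunE/=.
  by have /andP[_ ->] := hl i; have /andP[-> _] := hu i.
case: asboolP => // -[]; move=> s Bs /=; apply: dO.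
rewrite -ball_normE /ball_/=; apply: norm_rV_ltP => // i; rewrite !mxE.
have := Bs i; rewrite /A /= in_itv/= ffunE/= => /andP[ls su].
have /andP[tl _] := hl i; have /andP[_ ut] := hu i.
by rewrite ltr_norml; lra.
Qed.

Lemma measurable_row_continuous f : continuous f ->
  measurable_fun setT (f \o row).
Proof.
move=> cf; apply: (measurability _ (RGenOInfty.measurableE R)) => //.
move=> _ [_ [a ->] <-]; rewrite setTI.
rewrite comp_preimage; apply: measurable_row_open.
by apply: open_comp => [x _|]; [exact: cf|exact: interval_open].
Qed.

Definition compactly_supported f := exists2 K, compact K & supported_in K f.

Lemma compactly_supported_bound f : compactly_supported f ->
  exists2 r, 0 < r & forall x, r < `|x| -> f x = 0.
Proof.
move=> [K /compact_bounded[M [_ KM]] Kf].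
exists (`|M| + 1); first by rewrite ltr_wpDl.
move=> x Mx; apply: Kf => Kx.
have := KM (`|M| + 1); rewrite (le_lt_trans (ler_norm M)) ?ltrDl// => /(_ isT x Kx).
by rewrite /= leNgt Mx.
Qed.

Lemma continuous_compact_bounded f (K : set E) : continuous f -> compact K ->
  exists2 C, 0 < C & forall x, K x -> `|f x| <= C.
Proof.
move=> cf cK.
have /compact_bounded[M [_ KM]] : compact (f @` K).
  by apply: continuous_compact => //; exact: continuous_subspaceT.
exists (`|M| + 1); first by rewrite ltr_wpDl.
move=> x Kx; apply: (KM (`|M| + 1)); last by exists x.
by rewrite (le_lt_trans (ler_norm M)) ?ltrDl.
Qed.

Definition cube (a : E) (r : R) : set T :=
  coord_box (fun i => `[(a 0 i - r), (a 0 i + r)]%classic).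

Lemma measurable_cube a r : measurable (cube a r).
Proof. by apply: measurable_coord_box => i; exact: measurable_itv. Qed.

Lemma tuple_lebesgue_cube a r : 0 < r ->
  tuple_lebesgue R N (cube a r) = ((r + r) ^+ N)%:E.
Proof.
move=> r0; pose A i : set (measurableTypeR R) := `[(a 0 i - r), (a 0 i + r)]%classic.
have mA i : measurable (A i) by exact: measurable_itv.
apply: (etrans (tuple_lebesgue_box mA)).
transitivity (\prod_(i < N) (r + r)%:E)%E.
  apply: eq_bigr => i _; rewrite lebesgue_measure_itv/= lte_fin.
  rewrite ifT; last by rewrite ltrD2l gtrN.
  by rewrite -EFinB; congr (_%:E); ring.
by rewrite prodEFin prodr_const card_ord.
Qed.

Lemma cubeP a r t : 0 <= r -> `|row t - a| <= r <-> cube a r t.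
Proof.
move=> r0; split => h.
  move=> i; rewrite /= in_itv/=.
  have := le_trans (le_coord_norm _ i) h; rewrite !mxE ler_norml; lra.
rewrite [`|_|]mx_normrE; apply/bigmax_leP; split => // -[i j] _ /=.
by have := h j; rewrite /= in_itv/= ord1 !mxE ler_norml; lra.
Qed.

Lemma integrable_row f : continuous f -> compactly_supported f ->
  (tuple_lebesgue R N).-integrable setT (EFin \o (f \o row)).
Proof.
move=> cf sf; have [r r0 fr] := compactly_supported_bound sf.
have -> : EFin \o (f \o row) = (EFin \o (f \o row)) \_ (cube 0 r).
  apply/funext => t; rewrite patchE; case: ifPn => // /negP.
  rewrite inE => tr /=; rewrite fr// ltNge; apply/negP => h; apply: tr.
  by apply/(cubeP _ _ (ltW r0)); rewrite subr0.
have mc := measurable_cube 0 r.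
have [+ _] := @integrable_mkcond _ _ _ (tuple_lebesgue R N) _
  (EFin \o (f \o row)) mc; apply.
apply: measurable_bounded_integrable; first exact: measurable_cube.
- by rewrite [X in (X < _)%E](tuple_lebesgue_cube _ r0) ltry.
- by apply: measurable_funTS; exact: measurable_row_continuous.
have [C C0 fC] := continuous_compact_bounded cf (@compact_closed_ball R N 0 r).
exists C; split; first exact: num_real.
move=> M CM t /= /(cubeP _ _ (ltW r0)) tr.
by apply: le_trans (ltW CM); apply: fC; rewrite /closed_ball_/= distrC.
Qed.

Definition integralT f : R := integral_rV setT f.

Lemma integralTE f : integralT f = Rintegral (tuple_lebesgue R N) setT (f \o row).
Proof. by rewrite /integralT /integral_rV preimage_setT. Qed.

Lemma integralT_linear (a : R) f g : continuous f -> compactly_supported f ->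
  continuous g -> compactly_supported g ->
  integralT (fun x => a * f x + g x) = a * integralT f + integralT g.
Proof.
move=> cf sf cg sg; rewrite !integralTE.
have i1 := integrable_row cf sf; have i2 := integrable_row cg sg.
rewrite -RintegralZl// -RintegralD//.
have := integrableZl measurableT a i1.
by congr (integrable _ _ _).
Qed.

(** The continuity estimate that makes a function a distribution. *)
Lemma integralT_norm_le f (C r : R) : 0 < r -> continuous f ->
  compactly_supported f -> (forall x, r < `|x| -> f x = 0) ->
  (forall x, `|f x| <= C) -> `|integralT f| <= C * (r + r) ^+ N.
Proof.
move=> r0 cf sf fr fC; rewrite integralTE.
have i1 := integrable_row cf sf.
have mc := measurable_cube 0 r.
rewrite (_ : Rintegral _ _ _ =
    Rintegral (tuple_lebesgue R N) (cube 0 r) (f \o row)); last first.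
  rewrite [RHS]Rintegral_mkcond; congr Rintegral.
  apply/funext => t; rewrite patchE; case: ifPn => // /negP.
  rewrite inE => tr /=; rewrite fr// ltNge; apply/negP => h; apply: tr.
  by apply/(cubeP _ _ (ltW r0)); rewrite subr0.
have i2 : (tuple_lebesgue R N).-integrable (cube 0 r) (EFin \o (f \o row)).
  exact: integrableS i1.
apply: le_trans (le_normr_Rintegral _ i2) _ => //.
have fin : (tuple_lebesgue R N (cube 0 r) < +oo)%E.
  by rewrite [X in (X < _)%E](tuple_lebesgue_cube _ r0) ltry.
have -> : C * (r + r) ^+ N =
    Rintegral (tuple_lebesgue R N) (cube 0 r) (fun=> C).
  rewrite Rintegral_cst//; congr (_ * _).
  by rewrite [X in fine X](tuple_lebesgue_cube _ r0).
apply: le_Rintegral => //.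
- have := integrable_norm i2; exact.
- apply: measurable_bounded_integrable => //; exact: bounded_cst.
- by move=> t _; exact: fC.
Qed.

(** A positive value would bound the function below by half of it on a cube, which
    has positive measure. *)
Lemma integralT_eq0 f : continuous f -> compactly_supported f ->
  (forall x, 0 <= f x) -> integralT f = 0 -> forall x, f x = 0.
Proof.
move=> cf sf f0 If a; apply/eqP; rewrite eq_le f0 andbT leNgt; apply/negP => fa.
have fa2 : 0 < f a / 2 by rewrite divr_gt0.
have : \forall x \near a, f a / 2 < f x.
  have : f x @[x --> a] --> f a by exact: cf.
  move=> /cvgrPdist_lt/(_ _ fa2); apply: filterS => x.
  rewrite ltr_distl; lra.
move=> /nbhs_ballP[d /= d0 ad].
pose r := d / 2; have r0 : 0 < r by rewrite divr_gt0.
have mc := measurable_cube a r.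
have i1 := integrable_row cf sf.
have : (((f a / 2) * (r + r) ^+ N)%:E <=
    \int[tuple_lebesgue R N]_t ((f \o row) t)%:E)%E.
  apply: (@le_trans _ _ (\int[tuple_lebesgue R N]_(t in cube a r) (f a / 2)%:E)%E).
    by rewrite integral_cst//= [X in (_ <= _ * X)%E](tuple_lebesgue_cube _ r0) -EFinM.
  apply: (@le_trans _ _ (\int[tuple_lebesgue R N]_(t in cube a r) ((f \o row) t)%:E)%E).
    apply: ge0_le_integral => //.
    - by move=> t _; rewrite lee_fin ltW.
    - by apply/measurable_EFinP; apply: measurable_funTS;
        exact: measurable_row_continuous.
    - move=> t /(cubeP _ _ (ltW r0)) tr; rewrite lee_fin ltW//; apply: ad.
      rewrite -ball_normE /ball_/= distrC (le_lt_trans tr)//.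
      by rewrite /r ltr_pdivrMr// ltr_pMr// ltr1n.
  apply: ge0_subset_integral => //.
  - by apply/measurable_EFinP; exact: measurable_row_continuous.
  - by move=> t _; rewrite lee_fin; exact: f0.
have fin := integrable_fin_num measurableT i1.
move: If; rewrite integralTE /Rintegral => If.
rewrite -(fineK fin) [X in (_ <= X%:E)%E]If lee_fin leNgt mulr_gt0//.
by rewrite exprn_gt0// addr_gt0.
Qed.

End row_integration.

Section line_integration.
Context {R : realType}.
Local Notation tupleR n := (n.-tuple (measurableTypeR R)).

Definition tuple_upd n (t : tupleR n) (j : 'I_n) (s : measurableTypeR R) : tupleR n :=
  [tuple if i == j then s else tnth t i | i < n].

Lemma tuple_upd_tcons0 n (s0 s : measurableTypeR R) (t : tupleR n) :
  tuple_upd (tcons (s0, t)) ord0 s = tcons (s, t).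
Proof.
apply: eq_from_tnth => i; rewrite tnth_mktuple.
have [k ->|->] := unliftP ord0 i; last by rewrite eqxx tnth0.
by rewrite !tnthS.
Qed.

Lemma tuple_upd_tconsS n (s0 s : measurableTypeR R) (t : tupleR n) (j : 'I_n) :
  tuple_upd (tcons (s0, t)) (lift ord0 j) s = tcons (s0, tuple_upd t j s).
Proof.
apply: eq_from_tnth => i; rewrite tnth_mktuple.
have [k ->|->] := unliftP ord0 i; last by rewrite !tnth0.
by rewrite !tnthS tnth_mktuple (inj_eq lift_inj).
Qed.

(** Fubini in the [j]-th coordinate, by induction on the number of coordinates:
    the first coordinate is split off, and integrated first or last according
    to whether it is the [j]-th one. *)
Lemma integral_tuple_lines0 n (G : tupleR n -> R) (j : 'I_n) :
  (tuple_lebesgue R n).-integrable setT (EFin \o G) ->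
  (forall t, \int[lebesgue_measure]_s (G (tuple_upd t j s))%:E = 0)%E ->
  (\int[tuple_lebesgue R n]_t (G t)%:E = 0)%E.
Proof.
elim: n G j => [|n IH] G j iG G0; first by case: j G0.
have mt := @measurable_tcons R n.
have mG : measurable_fun setT (EFin \o G) := measurable_int _ iG.
set m := tuple_lebesgue R n.
have iGt : (lebesgue_measure \x m)%E.-integrable setT ((EFin \o G) \o @tcons R n).
  apply/integrableP; split; first exact: measurableT_comp.
  have /integrableP[_] := iG; apply: le_lt_trans.
  rewrite [leRHS](ge0_integral_pushforward mt)//.
  exact: measurableT_comp.
rewrite [LHS](integral_pushforward mt mG iGt measurableT) preimage_setT.
have [k jk|j0] := unliftP ord0 j.
  rewrite -(integral12_prod_meas1 iGt).
  have := ae_integrable1 iGt.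
  move=> ae; transitivity (\int[lebesgue_measure]_(s in [set: measurableTypeR R]) (0 : \bar R))%E.
    apply: ae_eq_integral => //; first exact: measurable_fubini_F iGt.
    apply: filterS ae => s /= iGs _.
    rewrite /fubini_F; apply: (IH (fun t => G (tcons (s, t))) k iGs).
    by move=> t; rewrite -[RHS](G0 (tcons (s, t))) jk;
      under [in RHS]eq_integral do rewrite tuple_upd_tconsS.
  exact: integral0.
rewrite -(integral21_prod_meas1 iGt).
under eq_integral => t _.
  rewrite /fubini_G.
  rewrite (_ : (fun x => _) = (fun s => (G (tuple_upd (tcons (0 : R, t)) j s))%:E)).
    rewrite G0; over.
  by apply/funext => s /=; rewrite j0 tuple_upd_tcons0.
exact: integral0.
Qed.

Lemma integral_derive_compact (F f : R -> R) (r : R) : 0 < r ->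
  (forall s : R, is_derive s 1 F (f s)) -> continuous f ->
  (forall s, r <= `|s| -> F s = 0 /\ f s = 0) ->
  (\int[lebesgue_measure]_s (f s)%:E = 0)%E.
Proof.
move=> r0 dF cf out.
have cF : continuous F.
  move=> s; apply: differentiable_continuous; apply/derivable1_diffP.
  exact: ex_derive.
have -> : (fun s : R => (f s)%:E) =
    (fun s : R => (f s)%:E) \_ (`[(- r), r]%classic : set R).
  apply/funext => s; rewrite patchE; case: ifPn => // /negP.
  rewrite inE /= in_itv/= => /negP; rewrite -ler_norml -ltNge => /ltW /out[_ ->].
  by [].
rewrite -integral_mkcond (@continuous_FTC2 _ f F).
- have [] := out r _; first by rewrite ger0_norm// ltW.
  have [] := out (- r) _; first by rewrite normrN ger0_norm// ltW.
  by move=> -> _ -> _; rewrite subee.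
- by rewrite gtrN.
- exact: continuous_subspaceT.
- split=> //.
  + exact/cvg_at_right_filter/cF.
  + exact/cvg_at_left_filter/cF.
- by move=> s _; rewrite derive1E derive_val.
Qed.

End line_integration.

Section integration_by_parts.
Context {R : realType} {N : nat}.
Local Notation E := 'rV[R]_N.
Implicit Types (f g : E -> R).

Lemma Ck_setT_continuous k f : Ck k setT f -> continuous f.
Proof. by move=> kf x; exact: Ck_continuous kf I. Qed.

Lemma supported_in_partial (K : set E) f i : closed K -> supported_in K f ->
  supported_in K (partial i f).
Proof.
move=> cK fK x Kx; rewrite (@partial_eq _ _ (~` K) f (fun=> 0) i x) //.
- exact: derive_cst.
- exact: closed_openC.
- by move=> y; rewrite inE; exact: fK.
Qed.

Lemma compactly_supported_partial f i : compactly_supported f ->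
  compactly_supported (partial i f).
Proof.
move=> [K cK fK]; exists K => //; apply: supported_in_partial => //.
apply: compact_closed => //; exact: norm_hausdorff.
Qed.

(** On every line parallel to the [i]-th axis the integrand is the derivative of a
    compactly supported function. *)
Lemma integralT_partial f i : Ck 1 setT f -> compactly_supported f ->
  integralT (partial i f) = 0.
Proof.
move=> kf sf; rewrite integralTE /Rintegral.
have cdf : continuous (partial i f) := Ck_setT_continuous (Ck_partial i kf).
have sdf := compactly_supported_partial i sf.
suff -> : (\int[tuple_lebesgue R N]_t (((partial i f) \o @row_of_tuple R N) t)%:E = 0)%E by [].
apply: (@integral_tuple_lines0 R N _ i); first exact: integrable_row.
move=> t.
have [r r0 fr] := compactly_supported_bound sf.
have [r' r'0 fr'] := compactly_supported_bound sdf.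
have E1 (s : R) : row_of_tuple (tuple_upd t i s) =
    s *: delta_mx 0 i + row_of_tuple (tuple_upd t i 0) :> E.
  apply/rowP => k; rewrite !mxE !tnth_mktuple eqxx andTb.
  by case: eqP => _; rewrite ?mulr1 ?addr0 ?mulr0 ?add0r.
have big (s : R) : `|s| <= `|(row_of_tuple (tuple_upd t i s) : E)|.
  apply: le_trans (le_coord_norm _ i).
  by rewrite mxE tnth_mktuple eqxx.
apply: (@integral_derive_compact R
   (fun s => f (s *: delta_mx 0 i + row_of_tuple (tuple_upd t i 0)))
   _ (Num.max r r' + 1)).
- by rewrite addr_gt0// lt_max r0.
- move=> s; rewrite /= (E1 s); apply: (is_derive_line _ _ _ _ _).1.
  exact: (Ck_is_derive i kf (I : setT _)).
- have -> : (fun s : R => (partial i f \o @row_of_tuple R N) (tuple_upd t i s)) =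
     partial i f \o (fun s => s *: delta_mx 0 i + row_of_tuple (tuple_upd t i 0)).
    by apply/funext => s /=; rewrite E1.
  move=> s; apply: continuous_comp; last exact: cdf.
  apply: cvgD; last exact: cvg_cst.
  exact: scalel_continuous.
- move=> s sr; have := big s; rewrite /= -E1 => bs.
  split; [apply: fr|apply: fr']; apply: lt_le_trans bs; apply: lt_le_trans sr.
    by rewrite (@le_lt_trans _ _ (Num.max r r')) ?le_max ?lexx// ltrDl.
  by rewrite (@le_lt_trans _ _ (Num.max r r')) ?le_max ?lexx ?orbT// ltrDl.
Qed.

End integration_by_parts.

(** * Test functions and weak formulations *)

Section test_functions.
Context {R : realType} {N : nat}.
Local Notation E := 'rV[R]_N.
Implicit Types (f g phi psi : E -> R) (U : set E).

Lemma compactly_supported_sub f g : compactly_supported f ->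
  (forall x, f x = 0 -> g x = 0) -> compactly_supported g.
Proof. by move=> [K cK fK] fg; exists K => // x /fK /fg. Qed.

Lemma compactly_supportedD f g : compactly_supported f ->
  compactly_supported g -> compactly_supported (fun x => f x + g x).
Proof.
move=> [K cK fK] [L cL gL]; exists (K `|` L); first exact: compactU.
by move=> x KLx; rewrite fK ?gL ?addr0// => ?; apply: KLx; [right|left].
Qed.

Lemma compactly_supported_sum (I : Type) (r : seq I) (F : I -> E -> R) :
  (forall j, compactly_supported (F j)) ->
  compactly_supported (fun x => \sum_(j <- r) F j x).
Proof.
move=> sF; elim: r => [|j r IH].
  exists set0; first exact: compact0.
  by move=> x _; rewrite big_nil.
under [fun _ => _]eq_fun do rewrite big_cons; exact: compactly_supportedD.
Qed.

Lemma test_function_supported U phi :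
  test_function U phi -> compactly_supported phi.
Proof. by move=> [_ [K [cK _ phiK]]]; exists K. Qed.

Lemma test_functionT phi : smooth setT phi -> compactly_supported phi ->
  test_function setT phi.
Proof. by move=> sphi [K cK phiK]; split => //; exists K. Qed.

Lemma test_functionM f phi : smooth setT f -> test_function setT phi ->
  test_function setT (fun x => f x * phi x).
Proof.
move=> sf tphi; apply: test_functionT.
  by apply: smoothM => //; [exact: openT|exact: tphi.1].
apply: compactly_supported_sub (test_function_supported tphi) _ => x ->.
by rewrite mulr0.
Qed.

Lemma test_function_partial phi i :
  test_function setT phi -> test_function setT (partial i phi).
Proof.
move=> tphi; apply: test_functionT; first exact/smooth_partial/tphi.1.
exact/compactly_supported_partial/(test_function_supported tphi).
Qed.

Lemma test_function_linear (a : R) phi psi : test_function setT phi ->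
  test_function setT psi -> test_function setT (fun x => a * phi x + psi x).
Proof.
move=> tphi tpsi; apply: test_functionT.
  move=> k; apply: CkD; [exact: openT| |exact: tpsi.1].
  by apply: CkZ; [exact: openT|exact: tphi.1].
apply: compactly_supportedD; last exact: test_function_supported tpsi.
apply: compactly_supported_sub (test_function_supported tphi) _ => x ->.
by rewrite mulr0.
Qed.

Lemma smooth_setT_continuous f : smooth setT f -> continuous f.
Proof. by move=> sf; exact: Ck_setT_continuous (sf 0%N). Qed.

Lemma le_Ck_norm0 phi : smooth setT phi -> compactly_supported phi ->
  forall x, `|phi x| <= Ck_norm 0 phi.
Proof.
move=> sphi [K cK phiK] x; rewrite /Ck_norm big_ord1.
rewrite (bigD1 [tuple])//= big1 ?addr0; last first.
  by move=> s; have -> : s = [tuple] by exact: tuple0; case/negP.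
have [C C0 phiC] := continuous_compact_bounded (smooth_setT_continuous sphi) cK.
apply: ub_le_sup; last by exists x.
exists C => _ [y _ <-] /=; have [/phiC//|Ky] := pselect (K y).
by rewrite phiK// normr0 ltW.
Qed.

Lemma integralT_sum (I : Type) (r : seq I) (F : I -> E -> R) :
  (forall j, continuous (F j)) -> (forall j, compactly_supported (F j)) ->
  integralT (fun x => \sum_(j <- r) F j x) = \sum_(j <- r) integralT (F j).
Proof.
move=> cF sF; elim: r => [|j r IH].
  under [fun _ => _]eq_fun do rewrite big_nil.
  by rewrite big_nil integralTE /Rintegral integral0.
rewrite big_cons -IH -[integralT (F j)]mul1r.
rewrite -integralT_linear//.
- by congr integralT; apply/funext => x; rewrite big_cons mul1r.
- move=> x; elim: (r) => [|k s IHs].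
    by under [fun _ => _]eq_fun do rewrite big_nil; exact: cst_continuous.
  by under [fun _ => _]eq_fun do rewrite big_cons;
    exact: (continuousD (@cF k x) IHs).
- exact: compactly_supported_sum.
Qed.

Lemma integralT_by_parts f g i : Ck 1 setT f -> Ck 1 setT g ->
  compactly_supported g ->
  integralT (fun x => f x * partial i g x) =
  - integralT (fun x => partial i f x * g x).
Proof.
move=> kf kg sg.
have sfg (h k : E -> R) : (forall x, k x = 0 -> h x = 0) ->
    compactly_supported k -> compactly_supported h.
  by move=> kh sk; exact: compactly_supported_sub sk kh.
have cM (h k : E -> R) : continuous h -> continuous k ->
    continuous (fun x => h x * k x).
  by move=> ch ck x; exact: continuousM (@ch x) (@ck x).
have cf := Ck_setT_continuous kf; have cg := Ck_setT_continuous kg.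
have cdf := Ck_setT_continuous (Ck_partial i kf).
have cdg := Ck_setT_continuous (Ck_partial i kg).
have kfg : Ck 1 setT (fun x => f x * g x) by apply: CkM => //; exact: openT.
have s0 : compactly_supported (fun x => f x * g x).
  by apply: sfg sg => x ->; rewrite mulr0.
have := integralT_partial i kfg s0.
have -> : partial i (fun x => f x * g x) =
    fun x => 1 * (partial i f x * g x) + f x * partial i g x.
  by apply/funext => x; rewrite (partialM i kf kg (I : setT x)) mul1r.
rewrite integralT_linear ?mul1r.
- by move=> /eqP; rewrite addrC addr_eq0 => /eqP.
- exact: cM.
- by apply: sfg sg => x ->; rewrite mulr0.
- exact: cM.
- apply: sfg (compactly_supported_partial i sg) => x ->; by rewrite mulr0.
Qed.

(** A nonzero value [f a] fixes the sign of [f] on a ball around [a], and a bump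
    inside this ball contradicts the positivity of the integral. *)
Lemma du_Bois_Reymond U f : open U -> continuous f ->
  (forall phi, test_function U phi -> integralT (fun x => f x * phi x) = 0) ->
  forall x, U x -> f x = 0.
Proof.
move=> oU cf f0 a Ua; apply/eqP; apply: contraT => fa0.
have fa2 : 0 < `|f a| by rewrite normr_gt0.
have : \forall x \near a, U x /\ 0 < f a * f x.
  near=> x; split; first by near: x; exact: open_nbhs_nbhs.
  have : `|f a - f x| < `|f a|.
    near: x; have : f x @[x --> a] --> f a by exact: cf.
    by move=> /cvgrPdist_lt/(_ _ fa2).
  have : 0 < f a ^+ 2 by rewrite exprn_even_gt0.
  have [fp|fn|fe] := ltgtP (f a) 0.
  - rewrite (ltr0_norm fp) ltr_norml; nra.
  - rewrite (gtr0_norm fn) ltr_norml; nra.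
  - by rewrite fe eqxx in fa0.
move=> /nbhs_ballP[d /= d0 ad].
pose r := d / 2; have r0 : 0 < r by rewrite divr_gt0.
have rd : r < d by rewrite /r ltr_pdivrMr// ltr_pMr// ltr1n.
have aU : closed_ball_ Num.norm a r `<=` ball a d.
  by move=> y /= ay; rewrite -ball_normE /ball_/= (le_lt_trans ay).
have tb : test_function U (bump a r).
  by apply: test_function_bump => // y /aU /ad[].
have cb : continuous (bump a r) by exact: smooth_setT_continuous tb.1.
have cfb : continuous (fun x => f x * bump a r x).
  by move=> x; exact: continuousM (@cf x) (@cb x).
have sfb : compactly_supported (fun x => f x * bump a r x).
  apply: compactly_supported_sub (test_function_supported tb) _ => x ->.
  by rewrite mulr0.
have c0 : continuous (fun _ : E => 0 : R) by move=> x; exact: cst_continuous.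
have s0 : compactly_supported (fun _ : E => 0 : R) by exists set0; first exact: compact0.
have : f a * (f a * bump a r a) + 0 = 0.
  apply: (@integralT_eq0 _ _ (fun x => f a * (f x * bump a r x) + 0)).
  - move=> x; apply: (@continuousD _ _ _ (fun x => f a * (f x * bump a r x))).
      by apply: (@continuousM _ _ (fun=> f a));
        [exact: cst_continuous|exact: cfb].
    exact: cst_continuous.
  - apply: compactly_supportedD => //.
    by apply: compactly_supported_sub sfb _ => x ->; rewrite mulr0.
  - move=> x; rewrite addr0 mulrA.
    have [bx|/eqP] := eqVneq (bump a r x) 0; first by rewrite bx mulr0.
    move=> bx; rewrite mulr_ge0 ?bump_ge0// ltW//; apply: (ad x _).2.
    apply: aU; rewrite /closed_ball_/= leNgt; apply/negP => h; apply: bx.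
    by apply: bump_eq0 => //; rewrite distrC ltW.
  - rewrite (integralT_linear (f a) cfb sfb c0 s0) f0// mulr0 add0r.
    by rewrite integralTE /Rintegral integral0.
move/eqP; rewrite addr0 mulrA mulf_eq0 (gt_eqF (bump_gt0 _)) ?sqdistxx ?exprn_gt0//.
by rewrite orbF mulf_eq0 (negbTE fa0).
Unshelve. all: by end_near. Qed.

End test_functions.

(** * A vanishing criterion for a derivative *)

Section signed_square.
Context {R : realType}.

Lemma is_derive_mul_norm (s : R) :
  is_derive s 1 (fun t : R => t * `|t|) (2 * `|s|).
Proof.
have dX : is_derive s 1 (fun t : R => t * t) (2 * s).
  have -> : 2 * s = id s *: (1 : R) + id s *: (1 : R).
    by rewrite /= [_ *: _]mulr1; ring.
  exact: is_deriveM.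
have [s0|s0|->] := ltgtP s 0.
- rewrite ltr0_norm// mulrN.
  apply: (@near_eq_is_derive _ _ _ (fun t : R => - (t * t))).
  by near=> t; rewrite ltr0_norm ?mulrN//; near: t; exact: lt_nbhsl.
- rewrite gtr0_norm//.
  apply: (@near_eq_is_derive _ _ _ (fun t : R => t * t)) => //.
  by near=> t; rewrite gtr0_norm//; near: t; exact: lt_nbhsr.
- rewrite normr0 mulr0.
  have cv : (fun h : R => h^-1 *: (((fun t : R => t * `|t|) \o shift (0 : R))
      (h *: (1 : R)) - (0 : R) * `|0 : R|)) @ (0 : R)^' --> (0 : R).
    apply/cvgr0Pnorm_le => e e0; near=> h.
    have h0 : h != 0 by near: h; exact: nbhs_dnbhs_neq.
    rewrite /= addr0 [h *: 1]mulr1 mul0r subr0 [_ *: _]mulKf// normr_id ltW//.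
    near: h; exact: dnbhs0_lt.
  by apply: DeriveDef; [apply/cvg_ex; exists 0|exact: cvg_lim cv].
Unshelve. all: by end_near. Qed.

(** Suppose that the slope [d] of [gam] at 0 is nonzero.  Near 0 the product
    [`|gam| * dgam] has the sign of [d] on both sides, so that its difference
    quotient [s^-1 * `|gam s| * dgam s] changes sign at 0.  The modulus of this
    quotient stays above [d ^ 2 / 4], so it has no limit. *)
Lemma deriv_eq0_of_norm_mul (gam dgam : R -> R) : gam 0 = 0 ->
  is_derive (0 : R) 1 gam (dgam 0) -> {for (0 : R), continuous dgam} ->
  derivable (fun s => `|gam s| * dgam s) 0 1 -> dgam 0 = 0.
Proof.
set d := dgam 0 => g0 [dg dgE] cdg /cvg_ex[l ul].
apply/eqP; apply: contraT => d0.
have cr : (fun s : R => s^-1 *: (gam s - 0)) @ 0^' --> d.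
  have -> : (fun s : R => s^-1 *: (gam s - 0)) =
      (fun h : R => h^-1 *: ((gam \o shift 0) (h *: 1) - gam 0)).
    by apply/funext => h; rewrite /= addr0 [h *: 1]mulr1 g0.
  by rewrite -dgE; exact: dg.
have {}ul : (fun s : R => s^-1 *: (`|gam s| * dgam s)) @ 0^' --> l.
  have -> : (fun s : R => s^-1 *: (`|gam s| * dgam s)) =
      (fun h : R => h^-1 *: (((fun s => `|gam s| * dgam s) \o shift 0) (h *: 1)
        - `|gam 0| * dgam 0)).
    by apply/funext => h; rewrite /= addr0 [h *: 1]mulr1 g0 normr0 mul0r subr0.
  exact: ul.
have d2 : 0 < `|d| / 2 by rewrite divr_gt0// normr_gt0.
have nd : \forall s \near (0 : R)^', `|d - dgam s| < `|d| / 2.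
  by move/cvgrPdist_lt : cdg => /(_ _ d2) /nbhs_dnbhs.
have nr : \forall s \near (0 : R)^', `|d - s^-1 *: (gam s - 0)| < `|d| / 2.
  by move/cvgrPdist_lt : cr => /(_ _ d2).
have l2 : 0 < `|d| * `|d| / 4 by rewrite divr_gt0// mulr_gt0 ?normr_gt0.
have nl : \forall s \near (0 : R)^',
    `|l - s^-1 *: (`|gam s| * dgam s)| < `|d| * `|d| / 4.
  by move/cvgrPdist_lt : ul => /(_ _ l2).
have : \forall s \near (0 : R)^', [/\ `|d - dgam s| < `|d| / 2,
    `|d - s^-1 *: (gam s - 0)| < `|d| / 2 &
    `|l - s^-1 *: (`|gam s| * dgam s)| < `|d| * `|d| / 4].
  by near=> s; split; near: s.
move=> /nbhs_ballP[r /= r0 H].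
have key s : s != 0 -> `|s| < r ->
    [/\ 0 < d * dgam s, `|d| / 2 <= `|s^-1 * `|gam s| | &
      `|l - s^-1 * `|gam s| * dgam s| < `|d| * `|d| / 4 /\ `|d| / 2 <= `|dgam s|].
  move=> s0 sr; have [|//|] := H s _.
    by rewrite -ball_normE /ball_/= sub0r normrN.
  rewrite subr0 /GRing.scale /= mulrA => h1 h2 h3.
  have dg2 : `|d| / 2 <= `|dgam s|.
    have := ler_distD (dgam s) d 0; rewrite !subr0; lra.
  have gg2 : `|d| / 2 <= `|s^-1 * gam s|.
    have := ler_distD (s^-1 * gam s) d 0; rewrite !subr0; lra.
  split=> //; last by rewrite normrM normr_id -normrM.
  move: h1; have [dp|dn|de] := ltgtP d 0.
  - rewrite (ltr0_norm dp) ltr_norml; nra.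
  - rewrite (gtr0_norm dn) ltr_norml; nra.
  - by rewrite de eqxx in d0.
have rr : 0 < r / 2 by rewrite divr_gt0.
have rr2 : r / 2 < r by rewrite ltr_pdivrMr// ltr_pMr// ltr1n.
have [||p1 p2 [p3 p4]] := key (r / 2).
- by rewrite gt_eqF.
- by rewrite gtr0_norm.
have [||q1 q2 [q3 q4]] := key (- (r / 2)).
- by rewrite oppr_eq0 gt_eqF.
- by rewrite normrN gtr0_norm.
move: p2 p3 q2 q3; rewrite invrN mulNr normrN.
set P := (r / 2)^-1 * `|gam (r / 2)|; set Q := (r / 2)^-1 * `|gam (- (r / 2))|.
have P0 : 0 <= P by rewrite mulr_ge0// invr_ge0 ltW.
have Q0 : 0 <= Q by rewrite mulr_ge0// invr_ge0 ltW.
rewrite (ger0_norm P0) (ger0_norm Q0) mulNr opprK => p2 p3 q2 q3.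
move: p1 p3 p4 q1 q3 q4; set x := dgam (r / 2); set y := dgam (- (r / 2)).
rewrite !ltr_norml => p1 p3 p4 q1 q3 q4.
have [dn|dp|de] := ltgtP d 0.
- have x0 : x < 0 by nra.
  have y0 : y < 0 by nra.
  move: p2 p3 p4 q2 q3 q4.
  rewrite (ltr0_norm dn) (ltr0_norm x0) (ltr0_norm y0) => p2 p3 p4 q2 q3 q4.
  have h1 : d * d / 4 <= P * - x by nra.
  have h2 : d * d / 4 <= Q * - y by nra.
  lra.
- have x0 : 0 < x by nra.
  have y0 : 0 < y by nra.
  move: p2 p3 p4 q2 q3 q4.
  rewrite (gtr0_norm dp) (gtr0_norm x0) (gtr0_norm y0) => p2 p3 p4 q2 q3 q4.
  have h1 : d * d / 4 <= P * x by nra.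
  have h2 : d * d / 4 <= Q * y by nra.
  lra.
- by rewrite de eqxx in d0.
Unshelve. all: by end_near. Qed.

End signed_square.

(** * Weak form of a divergence operator *)

Section divergence_form.
Context {R : realType} {N : nat}.
Local Notation E := 'rV[R]_N.
Variables (V : E -> R) (A : E -> 'M[R]_N).
Hypotheses (V_smooth : smooth setT V) (V_gt0 : forall x, 0 < V x).
Hypothesis A_smooth : forall i j, smooth setT (fun x => A x i j).
Hypothesis A_sym : forall x, (A x)^T = A x.
Implicit Types (f g phi psi : E -> R) (U : set E).

Definition grad f (x : E) : E := \row_i partial i f x.

(** The operator without the factor [(V x)^-1]: it is symmetric for Lebesgue measure,
    whereas [div_op V A] is symmetric for the density [V]. *)
Definition div_part psi (x : E) : R :=
  \sum_i \sum_j partial i (fun y => V y * A y i j * partial j psi y) x.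

Lemma smooth_coef i j : smooth setT (fun y => V y * A y i j).
Proof. by apply: smoothM => //; exact: openT. Qed.

Lemma Ck_flux k U psi i j : open U -> Ck k.+1 U psi ->
  Ck k U (fun y => V y * A y i j * partial j psi y).
Proof.
move=> oU kpsi; apply: CkM => //; last exact: Ck_partial.
exact: (Ck_subset (@subsetT _ U) (smooth_coef i j k)).
Qed.

Lemma div_op_linear U f g (a : R) x : open U -> Ck 2 U f -> Ck 2 U g -> U x ->
  div_op V A (fun y => a * f y + g y) x = a * div_op V A f x + div_op V A g x.
Proof.
move=> oU kf kg Ux; rewrite /div_op mulrCA -mulrDr; congr (_ * _).
rewrite mulr_sumr -big_split; apply: eq_bigr => i _ /=.
rewrite mulr_sumr -big_split; apply: eq_bigr => j _ /=.
have kf1 := Ck_pred kf; have kg1 := Ck_pred kg.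
have kaf : Ck 1 U (fun y => a * f y) by exact: CkZ.
have dfg y : U y -> partial j (fun y => a * f y + g y) y =
    a * partial j f y + partial j g y.
  move=> Uy; rewrite (partialD j kaf kg1 Uy); congr (_ + _).
  rewrite (partialM j (Ck_cst 1 U a) kf1 Uy).
  by rewrite {1}/partial derive_cst mul0r add0r.
rewrite (@partial_eq _ _ U _ (fun y => a * (V y * A y i j * partial j f y) +
    V y * A y i j * partial j g y) i x oU _ Ux); last first.
  by move=> y; rewrite inE => Uy; rewrite dfg//; ring.
have kFf := Ck_flux i j oU kf; have kFg := Ck_flux i j oU kg.
rewrite (partialD i (CkZ a oU kFf) kFg Ux); congr (_ + _).
rewrite (partialM i (Ck_cst 1 U a) kFf Ux).
by rewrite {1}/partial derive_cst mul0r add0r.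
Qed.

Lemma div_op_cst (a : R) x : div_op V A (fun=> a) x = 0.
Proof.
rewrite /div_op big1 ?mulr0// => i _; rewrite big1// => j _.
rewrite (_ : (fun y => _) = fun=> 0); first exact: derive_cst.
apply/funext => y; rewrite (_ : partial j _ y = 0) ?mulr0//; exact: derive_cst.
Qed.

Lemma test_function_flux psi i j : test_function setT psi ->
  test_function setT (fun y => V y * A y i j * partial j psi y).
Proof.
by move=> tpsi; apply: test_functionM;
  [exact: smooth_coef|exact: test_function_partial].
Qed.

Lemma test_function_sum (I : Type) (r : seq I) (F : I -> E -> R) :
  (forall j, test_function setT (F j)) ->
  test_function setT (fun x => \sum_(j <- r) F j x).
Proof.
move=> tF; apply: test_functionT.
  by apply: smooth_sum => [|j]; [exact: openT|exact: (tF j).1].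
by apply: compactly_supported_sum => j; exact: test_function_supported (tF j).
Qed.

Lemma test_function_div_part psi : test_function setT psi ->
  test_function setT (div_part psi).
Proof.
move=> tpsi; apply: test_function_sum => i; apply: test_function_sum => j.
exact/test_function_partial/test_function_flux.
Qed.

Lemma smooth_invV : smooth setT (fun x => (V x)^-1).
Proof. by apply: smoothV => //; [exact: openT|move=> x _; rewrite gt_eqF]. Qed.

Lemma distribution_sum T (I : Type) (r : seq I) (F : I -> E -> R) :
  Defs.distribution setT T -> (forall j, test_function setT (F j)) ->
  T (fun x => \sum_(j <- r) F j x) = \sum_(j <- r) T (F j).
Proof.
move=> [linT _] tF.
have t0 : test_function setT (fun _ : E => 0 : R).
  apply: test_functionT; first by move=> k; exact: Ck_cst.
  by exists set0; first exact: compact0.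
elim: r => [|j r IH].
  under [X in T X]eq_fun do rewrite big_nil.
  rewrite big_nil; have := linT 1 _ _ t0 t0.
  rewrite (_ : (fun x : E => 1 * 0 + 0) = fun=> 0).
    by rewrite mul1r => /eqP; rewrite eq_sym addrC -subr_eq0 addrK => /eqP.
  by apply/funext => x; rewrite mulr0 addr0.
rewrite big_cons -IH -[T (F j)]mul1r -linT//; last exact: test_function_sum.
by congr T; apply/funext => x; rewrite big_cons mul1r.
Qed.

(** Two signs cancel, and the symmetry of [A] exchanges the roles of the two
    derivatives when they are moved from [T] to [phi]. *)
Lemma div_op_distrE T phi : Defs.distribution setT T -> test_function setT phi ->
  div_op_distr V A T phi = T (div_part (fun x => (V x)^-1 * phi x)).
Proof.
move=> dT tphi; have tpsi := test_functionM smooth_invV tphi.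
set psi := fun x => (V x)^-1 * phi x in tpsi *.
rewrite /div_part (distribution_sum _ dT); last first.
  move=> i; apply: test_function_sum => j.
  exact/test_function_partial/test_function_flux.
rewrite /div_op_distr /distr_mul /distr_partial exchange_big /=.
apply: eq_bigr => i _; rewrite (distribution_sum _ dT); last first.
  by move=> j; exact/test_function_partial/test_function_flux.
apply: eq_bigr => j _; rewrite opprK; congr T; congr (partial i _).
by apply/funext => y; rewrite -[in LHS](A_sym y) mxE.
Qed.

(** One integration by parts only, so that [f] need not be twice differentiable.
    *)
Lemma integralT_div_part f psi : Ck 1 setT f -> test_function setT psi ->
  integralT (fun x => f x * div_part psi x) =
  - integralT (fun x => V x * mxform (A x) (grad f x) (grad psi x)).
Proof.
move=> kf tpsi.
have cM (h k : E -> R) : continuous h -> continuous k ->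
    continuous (fun x => h x * k x).
  by move=> ch ck x; exact: continuousM (@ch x) (@ck x).
have cf := Ck_setT_continuous kf.
have cdf i := Ck_setT_continuous (Ck_partial i kf).
have sM (h k : E -> R) : compactly_supported k ->
    compactly_supported (fun x => h x * k x).
  by move=> sk; apply: compactly_supported_sub sk _ => x ->; rewrite mulr0.
pose F i j := fun y => V y * A y i j * partial j psi y.
have tF i j : test_function setT (F i j) by exact: test_function_flux.
have cF i j : continuous (F i j) := smooth_setT_continuous (tF i j).1.
have sF i j := test_function_supported (tF i j).
have tdF i j := test_function_partial i (tF i j).
have cdF i j := smooth_setT_continuous (tdF i j).1.
have sdF i j := test_function_supported (tdF i j).
have contsum (I : Type) (r : seq I) (G : I -> E -> R) :
    (forall k, continuous (G k)) -> continuous (fun x => \sum_(k <- r) G k x).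
  move=> cG x; elim: r => [|k s IHs].
    by under [fun _ => _]eq_fun do rewrite big_nil; exact: cst_continuous.
  by under [fun _ => _]eq_fun do rewrite big_cons;
    exact: (continuousD (@cG k x) IHs).
rewrite (_ : (fun x => f x * div_part psi x) =
    fun x => \sum_i \sum_j f x * partial i (F i j) x); last first.
  by apply/funext => x; rewrite mulr_sumr; apply: eq_bigr => i _;
    rewrite mulr_sumr.
rewrite (_ : (fun x => V x * mxform _ _ _) =
    fun x => \sum_i \sum_j partial i f x * F i j x); last first.
  apply/funext => x; rewrite mxformE mulr_sumr; apply: eq_bigr => i _.
  rewrite mulr_sumr; apply: eq_bigr => j _; rewrite /F !mxE; ring.
rewrite integralT_sum; last first.
- by move=> i; apply: compactly_supported_sum => j; exact: sM.
- by move=> i; apply: contsum => j; exact: cM.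
rewrite integralT_sum; last first.
- by move=> i; apply: compactly_supported_sum => j; exact: sM.
- by move=> i; apply: contsum => j; exact: cM.
rewrite -sumrN; apply: eq_bigr => i _.
rewrite integralT_sum; last first.
- by move=> j; exact: sM.
- by move=> j; exact: cM.
rewrite integralT_sum; last first.
- by move=> j; exact: sM.
- by move=> j; exact: cM.
rewrite -sumrN; apply: eq_bigr => j _.
by apply: integralT_by_parts => //; exact: (tF i j).1.
Qed.

Lemma distribution_of_continuous f : continuous f ->
  Defs.distribution setT (distr_of_fun setT f).
Proof.
move=> cf.
have cM (k : E -> R) : continuous k -> continuous (fun x => f x * k x).
  by move=> ck x; exact: continuousM (@cf x) (@ck x).
have sM (k : E -> R) : compactly_supported k ->
    compactly_supported (fun x => f x * k x).
  by move=> sk; apply: compactly_supported_sub sk _ => x ->; rewrite mulr0.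
split=> [a phi psi tphi tpsi|K cK _].
  have cphi := smooth_setT_continuous tphi.1.
  have cpsi := smooth_setT_continuous tpsi.1.
  have sphi := test_function_supported tphi.
  have spsi := test_function_supported tpsi.
  rewrite [RHS](_ : _ = a * integralT (fun x => f x * phi x) +
    integralT (fun x => f x * psi x))//.
  rewrite -(integralT_linear a (cM _ cphi) (sM _ sphi) (cM _ cpsi) (sM _ spsi)).
  rewrite /distr_of_fun -/(integralT _); congr integralT.
  by apply/funext => x; ring.
have [C C0 fC] := continuous_compact_bounded cf cK.
have [M [_ KM]] := compact_bounded cK.
pose r := `|M| + 1; have r0 : 0 < r by rewrite ltr_wpDl.
exists (C * (r + r) ^+ N), 0%N => phi sphi phiK.
have cphi := smooth_setT_continuous sphi.
have csphi : compactly_supported phi by exists K.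
rewrite mulrAC; apply: (integralT_norm_le r0 (cM _ cphi) (sM _ csphi)) => x.
  move=> rx; rewrite phiK ?mulr0// => Kx.
  have := KM r; rewrite (le_lt_trans (ler_norm M)) ?ltrDl// => /(_ isT x Kx).
  by rewrite /= leNgt rx.
rewrite normrM; have nphi := le_Ck_norm0 sphi csphi x.
have [Kx|Kx] := pselect (K x).
  by apply: ler_pM => //; exact: fC.
by rewrite phiK// normr0 mulr0 mulr_ge0 ?(ltW C0)// (le_trans _ nphi).
Qed.

End divergence_form.

(** * Compactly supported elements of the kernel *)

Section hypoelliptic_kernel.
Context {R : realType} {N : nat}.
Local Notation E := 'rV[R]_N.
Variables (V : E -> R) (A : E -> 'M[R]_N).
Hypotheses (V_smooth : smooth setT V) (V_gt0 : forall x, 0 < V x).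
Hypothesis A_smooth : forall i j, smooth setT (fun x => A x i j).
Hypothesis A_sym : forall x, (A x)^T = A x.
Hypothesis A_psd : forall x, psd_mx (A x).
Hypothesis N_gt0 : (0 < N)%N.
Hypothesis L_hypo : hypoelliptic (div_op_distr V A) [set: E].
Implicit Types (f g phi psi : E -> R).

(** Hypoellipticity for the right-hand side 0, on the whole space. *)
Lemma hypoelliptic_kernel T : Defs.distribution setT T ->
  (forall psi, test_function setT psi -> T (div_part V A psi) = 0) ->
  exists2 g, smooth setT g & forall phi, test_function setT phi ->
    T phi = integralT (fun x => g x * phi x).
Proof.
move=> dT T0.
have s0 : smooth setT (fun _ : E => 0 : R) by move=> k; exact: Ck_cst.
have [phi tphi|g [sg Tg]] := L_hypo dT openT (@subsetT _ _) s0; last first.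
  by exists g => // phi tphi; rewrite Tg.
rewrite div_op_distrE// T0; last first.
  by apply: test_functionM => //; exact: smooth_invV.
rewrite [RHS](_ : _ = integralT (fun x => 0 * phi x))//.
rewrite integralTE /Rintegral; under eq_integral do rewrite /= mul0r.
by rewrite integral0.
Qed.

(** The energy identity: integrating [g] against its own equation gives the integral
    of the nonnegative function [V * <A grad g, grad g>], and a positive
    semidefinite matrix annihilates its isotropic vectors. *)
Lemma compact_kernel_flat g : test_function setT g ->
  integralT (fun x => g x * div_part V A g x) = 0 ->
  forall x i, \sum_j A x i j * partial j g x = 0.
Proof.
move=> tg g0.
have kg : Ck 1 setT g by exact: tg.1.
have sg := test_function_supported tg.
have F0 : forall x, V x * mxform (A x) (grad g x) (grad g x) = 0.
  apply: integralT_eq0.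
  - rewrite (_ : (fun x => _) = fun x =>
        \sum_i \sum_j partial i g x * (V x * A x i j * partial j g x)).
      apply: smooth_setT_continuous.
      apply: smooth_sum => [|i]; first exact: openT.
      apply: smooth_sum => [|j]; first exact: openT.
      apply: smoothM; first exact: openT.
        exact/smooth_partial/tg.1.
      exact: (test_function_flux V_smooth A_smooth i j tg).1.
    apply/funext => x; rewrite mxformE mulr_sumr; apply: eq_bigr => i _.
    by rewrite mulr_sumr; apply: eq_bigr => j _; rewrite !mxE; ring.
  - have sum : compactly_supported (fun x => \sum_i \sum_j
        (V x * A x i j * partial i g x * partial j g x)).
      apply: compactly_supported_sum => i; apply: compactly_supported_sum => j.
      apply: compactly_supported_sub (compactly_supported_partial j sg) _ => x ->.
      by rewrite mulr0.
    apply: compactly_supported_sub sum _ => x <-.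
    rewrite mxformE mulr_sumr; apply: eq_bigr => i _.
    by rewrite mulr_sumr; apply: eq_bigr => j _; rewrite !mxE; ring.
  - by move=> x; rewrite mulr_ge0//; [exact: ltW|exact: A_psd].
  - by apply: oppr_inj; rewrite -integralT_div_part// g0 oppr0.
move=> x i.
have : mxform (A x) (grad g x) (delta_mx 0 i) = 0.
  apply: psd_isotropic => //; apply/eqP; have := F0 x; move/eqP.
  by rewrite mulf_eq0 gt_eqF.
rewrite mxformE exchange_big /= (bigD1 i)//= [X in _ + X]big1 ?addr0; last first.
  move=> j ji; rewrite big1// => k _.
  by rewrite [delta_mx _ _ _ _]mxE (negbTE ji) andbF mulr0.
move=> h; rewrite -[RHS]h; apply: eq_bigr => j _.
by rewrite !mxE !eqxx mulr1 mulrC -[in LHS](A_sym x) mxE.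
Qed.

(** Every [C^1] function of [g], smooth or not, is annihilated by the operator,
    because [A] kills the gradient of [g].  Hypoellipticity thus makes
    [(g - t) * `|g - t|] smooth, which is impossible where [g] takes the value [t]
    with a nonzero gradient; and [t] may be any value of [g]. *)
Lemma flat_grad_eq0 g : smooth setT g ->
  (forall x i, \sum_j A x i j * partial j g x = 0) ->
  forall x i, partial i g x = 0.
Proof.
move=> sg Ag x i; pose t := g x.
pose f y := (g y - t) * `|g y - t|.
have kgt : Ck 1 setT (fun y => g y - t).
  by apply: CkB; [exact: openT|exact: sg|exact: Ck_cst].
have dgt j y : is_derive y (delta_mx 0 j) (fun y => g y - t) (partial j g y).
  have := Ck_is_derive j kgt (I : setT y).
  rewrite {1}/partial deriveB; [|exact: Ck_derivable (sg 1%N) I|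
    exact: derivable_cst].
  by rewrite derive_cst subr0.
have df j y : is_derive y (delta_mx 0 j) f (2 * `|g y - t| * partial j g y).
  exact: (is_derive_chain (is_derive_mul_norm _) (dgt j y)).
have dfE j : partial j f = fun y => 2 * `|g y - t| * partial j g y.
  by apply/funext => y; have [_] := df j y.
have cgt : continuous (fun y => g y - t) := Ck_setT_continuous kgt.
have cng : continuous (fun y => `|g y - t|).
  by move=> y; exact: cvg_norm (@cgt y).
have cf : continuous f.
  by move=> y; exact: continuousM (@cgt y) (@cng y).
have kf : Ck 1 setT f.
  split; first by move=> y _; exact: cf.
  move=> j; split; first by move=> y _; have [] := df j y.
  split=> // y _; rewrite dfE.
  apply: (@continuousM _ _ (fun y => 2 * `|g y - t|)).
    by apply: (@continuousM _ _ (fun=> 2)); [exact: cst_continuous|exact: cng].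
  exact: smooth_setT_continuous (smooth_partial j sg) _.
have [psi tpsi|h sh fh] := hypoelliptic_kernel (distribution_of_continuous cf).
  rewrite [LHS](_ : _ = integralT (fun y => f y * div_part V A psi y))//.
  rewrite integralT_div_part//.
  rewrite (_ : (fun y => _) = fun=> 0).
    by rewrite integralTE /Rintegral integral0 oppr0.
  apply/funext => y; rewrite mxformE exchange_big big1 ?mulr0// => j _ /=.
  rewrite -mulr_suml (_ : \sum_k _ = 0) ?mul0r//.
  transitivity (2 * `|g y - t| * \sum_k A y j k * partial k g y).
    rewrite mulr_sumr; apply: eq_bigr => k _.
    rewrite mxE dfE -[in LHS](A_sym y) mxE; ring.
  by rewrite Ag mulr0.
have fhE : f = h.
  apply/funext => y; apply/eqP; rewrite -subr_eq0; apply/eqP.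
  have ch := smooth_setT_continuous sh.
  apply: (@du_Bois_Reymond _ _ setT (fun y => f y - h y)) => //; first exact: openT.
    by move=> z; exact: continuousB (@cf z) (@ch z).
  move=> phi tphi.
  have cphi := smooth_setT_continuous tphi.1.
  have sphi := test_function_supported tphi.
  have cM (k : E -> R) : continuous k -> continuous (fun x => k x * phi x).
    by move=> ck z; exact: continuousM (@ck z) (@cphi z).
  have sM (k : E -> R) : compactly_supported (fun x => k x * phi x).
    by apply: compactly_supported_sub sphi _ => z ->; rewrite mulr0.
  have := integralT_linear (-1) (cM _ ch) (sM h) (cM _ cf) (sM f).
  rewrite -(fh _ tphi) [distr_of_fun _ _ _](_ : _ =
    integralT (fun y => f y * phi y))// mulN1r addNr => <-.
  by congr integralT; apply/funext => z; ring.
have sf : smooth setT f by rewrite fhE.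
have dd : derivable (partial i f) x (delta_mx 0 i) :=
  Ck_derivable (smooth_partial i sf 1%N) (I : setT x).
pose e : E := delta_mx 0 i.
have := @deriv_eq0_of_norm_mul R (fun s => g (s *: e + x) - t)
  (fun s => partial i g (s *: e + x)).
rewrite scale0r add0r; apply.
- by rewrite /t subrr.
- exact: (is_derive_line0 _ _ _ _).1.
- have cl : continuous (fun s : R => s *: e + x).
    move=> s; apply: cvgD; last exact: cvg_cst.
    exact: scalel_continuous.
  apply: continuous_comp; first exact: cl.
  exact: smooth_setT_continuous (smooth_partial i sg) _.
- have := (derivable1P _ _ _).1 dd.
  rewrite (_ : (fun s : R => _) = (fun s : R => 2 * (`|g (s *: e + x) - t| *
      partial i g (s *: e + x)))); last first.
    by apply/funext => s; rewrite dfE mulrA.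
  move=> d2.
  rewrite (_ : (fun s => `|_| * _) = (2^-1 : R) \*: (fun s : R =>
      2 * (`|g (s *: e + x) - t| * partial i g (s *: e + x)))).
    exact: derivableZ.
  by apply/funext => s; rewrite /= /GRing.scale /= mulKf.
Qed.

Lemma compactly_supported_cst0 g : Ck 1 setT g -> compactly_supported g ->
  (forall x i, partial i g x = 0) -> forall x, g x = 0.
Proof.
move=> kg sg dg x.
have [r r0 gr] := compactly_supported_bound sg.
pose i := Ordinal N_gt0; pose e : E := delta_mx 0 i.
(* Far enough along the axis to leave the ball of radius [r] that supports [g].
   *)
pose b := `|x| + r + 1.
have [s _] := @MVT_from0 R (fun s => g (s *: e + x))
  (fun s => partial i g (s *: e + x)) b
  (fun s _ => (is_derive_line _ _ _ _ _).1 (Ck_is_derive i kg (I : setT _))).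
rewrite dg mul0r scale0r add0r => /eqP; rewrite subr_eq0 => /eqP <-.
apply: gr.
have b0 : 0 <= b by rewrite /b addr_ge0// addr_ge0// ltW.
have eb : b <= `|b *: e|.
  apply: le_trans (le_coord_norm _ i).
  by rewrite !mxE !eqxx mulr1 ger0_norm.
have := lerB_normD (b *: e) x.
rewrite /b in eb *; have := normr_ge0 x; lra.
Qed.

(** Dividing test functions by [V] turns [l] into a distribution that the operator
    annihilates.  It has a smooth density [g], which vanishes off [K] because [l]
    only depends on values in [K]; so [g] is itself a test function and the energy
    identity applies to it. *)
Lemma invariant_functional_eq0 (K : set E) (l : (E -> R) -> R) :
  compact K ->
  (forall a phi psi, test_function setT phi -> test_function setT psi ->
    l (fun x => a * phi x + psi x) = a * l phi + l psi) ->
  (forall phi M, test_function setT phi -> (forall x, K x -> `|phi x| <= M) ->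
    `|l phi| <= M) ->
  (forall psi, test_function setT psi -> l (div_op V A psi) = 0) ->
  forall phi, test_function setT phi -> l phi = 0.
Proof.
move=> cK linl lK lL.
have sVi : smooth setT (fun x => (V x)^-1) by exact: smooth_invV.
pose T phi := l (fun x => (V x)^-1 * phi x).
have tV phi : test_function setT phi ->
    test_function setT (fun x => (V x)^-1 * phi x) by exact: test_functionM.
have dT : Defs.distribution setT T.
  split.
    move=> a phi psi tphi tpsi; rewrite /T -linl; [|exact: tV|exact: tV].
    by congr l; apply/funext => x; ring.
  move=> K' cK' _.
  have [C C0 VC] := continuous_compact_bounded (smooth_setT_continuous sVi) cK.
  exists C, 0%N => phi sphi phiK'.
  have cphi : compactly_supported phi by exists K'.
  apply: lK; first exact/tV/test_functionT.
  move=> x Kx; rewrite normrM; apply: ler_pM => //; first exact: VC.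
  exact: le_Ck_norm0.
have [psi tpsi|g sg Tg] := hypoelliptic_kernel dT; first exact: lL.
have clK : closed K by apply: compact_closed => //; exact: norm_hausdorff.
have gK : supported_in K g.
  move=> x Kx; apply: (@du_Bois_Reymond _ _ (~` K) g) => //.
  - exact: closed_openC.
  - exact: smooth_setT_continuous.
  move=> phi [sphi [L [cL LK phiL]]].
  have tphi : test_function setT phi by split => //; exists L.
  rewrite -Tg//; apply/eqP; rewrite -normr_le0; apply: lK; first exact: tV.
  move=> y Ky; rewrite phiL ?mulr0 ?normr0// => /LK; exact.
have csg : compactly_supported g by exists K.
have tg : test_function setT g by exact: test_functionT.
have g0 : integralT (fun x => g x * div_part V A g x) = 0.
  by rewrite -Tg; [exact: lL|exact: test_function_div_part].
have dg0 := flat_grad_eq0 sg (compact_kernel_flat tg g0).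
have {}g0 := compactly_supported_cst0 (sg 1%N) csg dg0.
move=> phi tphi.
have : T (fun x => V x * phi x) = 0.
  rewrite Tg; last exact: test_functionM.
  rewrite integralTE /Rintegral; under eq_integral do rewrite /= g0 mul0r.
  by rewrite integral0.
rewrite /T (_ : (fun x => _) = phi)//.
by apply/funext => x; rewrite mulKf// gt_eqF.
Qed.

End hypoelliptic_kernel.

(** * Strict subsolutions on compact sets *)

Section strict_subsolutions.
Context {R : realType} {N : nat}.
Local Notation E := 'rV[R]_N.
Variables (V : E -> R) (A : E -> 'M[R]_N).
Hypotheses (V_smooth : smooth setT V) (V_gt0 : forall x, 0 < V x).
Hypothesis A_smooth : forall i j, smooth setT (fun x => A x i j).
Hypothesis A_sym : forall x, (A x)^T = A x.
Hypothesis A_psd : forall x, psd_mx (A x).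
Hypothesis N_gt0 : (0 < N)%N.
Hypothesis L_hypo : hypoelliptic (div_op_distr V A) [set: E].

Lemma exists_test_function_gt0 (K : set E) : compact K ->
  exists2 phi : E -> R, test_function setT phi & forall x, K x -> 0 < phi x.
Proof.
move=> cK.
have sq : smooth setT (sqdist (0 : E)).
  apply: smooth_sum => [|i]; first exact: openT.
  move=> k; under eq_fun do rewrite expr2.
  by apply: CkM; [exact: openT| |]; apply: CkB;
    [exact: openT|exact: Ck_coord|exact: Ck_cst|exact: openT|
     exact: Ck_coord|exact: Ck_cst].
have [C C0 KC] := continuous_compact_bounded (smooth_setT_continuous sq) cK.
exists (bump 0 (C + 1)).
  by apply: test_function_bump => //; rewrite addr_gt0.
move=> x /KC /ler_normlW xC; apply: bump_gt0; apply: le_lt_trans xC _; nra.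
Qed.

(** If no [phi] existed, no function [div_op V A psi] would be positive on all of
    [K]; separating this linear space from the positive cone by Hahn-Banach
    would give a nonzero invariant functional. *)
Theorem strict_subsolution (K : set E) : compact K ->
  exists2 phi : E -> R, test_function setT phi &
    forall x, K x -> 0 < div_op V A phi x.
Proof.
move=> cK.
have t0 : test_function setT (fun _ : E => 0 : R).
  apply: test_functionT; first by move=> k; exact: Ck_cst.
  by exists set0; first exact: compact0.
have [[x0 Kx0]|K0] := pselect (K !=set0); last first.
  by exists (fun=> 0) => // x Kx; exfalso; apply: K0; exists x.
apply: contrapT => nophi.
have noP psi : test_function setT psi ->
    exists x, K x /\ div_op V A psi x <= 0.
  move=> tpsi; apply: contrapT => h; apply: nophi; exists psi => // x Kx.
  by rewrite ltNge; apply/negP => Lx; apply: h; exists x.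
have divL (a : R) (f g : E -> R) : test_function setT f ->
    test_function setT g -> div_op V A (fun y => a * f y + g y) =
      fun x => a * div_op V A f x + div_op V A g x.
  move=> tf tg; apply/funext => x.
  exact: (div_op_linear V_smooth A_smooth a openT (tf.1 2%N) (tg.1 2%N) I).
have Ltest psi : test_function setT psi -> test_function setT (div_op V A psi).
  move=> tpsi; apply: (test_functionM (smooth_invV V_smooth V_gt0)).
  exact: test_function_div_part.
pose D : set (E -> R) := [set f | exists M, forall x, K x -> `|f x| <= M].
have subD : subspace D.
  split; first by exists 0 => x _; rewrite normr0.
  move=> a f g [M fM] [M' gM']; exists (`|a| * M + M') => x Kx.
  rewrite (le_trans (ler_normD _ _))// lerD ?gM'//.
  by rewrite normrM ler_wpM2l ?fM.
have testD f : test_function setT f -> D f.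
  move=> tf.
  have [C _ fC] := continuous_compact_bounded (smooth_setT_continuous tf.1) cK.
  by exists C.
pose p (f : E -> R) := sup (f @` K).
have hsup f : D f -> has_sup (f @` K).
  move=> [M fM]; split; first by exists (f x0), x0.
  by exists M => _ [x Kx <-]; exact: le_trans (ler_norm _) (fM x Kx).
have pge f x : D f -> K x -> f x <= p f.
  by move=> Df Kx; apply: ub_le_sup; [exact: (hsup f Df).2|exists x].
have ple f M : (forall x, K x -> f x <= M) -> p f <= M.
  move=> fM; apply: ge_sup; first by exists (f x0), x0.
  by move=> _ [x Kx <-]; exact: fM.
have subp : sublinear_on D p.
  split=> [f g Df Dg|a f a0 Df].
    by apply: ple => x Kx; apply: lerD; exact: pge.
  by apply: ple => x Kx; apply: ler_wpM2l; [exact: ltW|exact: pge].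
pose W : set (E -> R) := [set div_op V A psi | psi in test_function setT].
have subW : subspace W.
  split.
    exists (fun=> 0) => //; apply/funext => x; exact: div_op_cst.
  move=> a _ _ [f tf <-] [g tg <-].
  exists (fun y => a * f y + g y); first exact: test_function_linear.
  by rewrite divL.
have WD : W `<=` D by move=> _ [f tf <-]; exact/testD/Ltest.
have Wp w : W w -> 0 <= p w.
  move=> [f tf <-].
  have [x [Kx Lx]] := noP _ (test_function_linear (-1) tf t0).
  move: Lx; rewrite divL// div_op_cst addr0 mulN1r oppr_le0 => Lx.
  exact: le_trans Lx (pge _ _ (testD _ (Ltest _ tf)) Kx).
have [l [linl lp lW]] := hahn_banach subD subp subW WD Wp.
have l0 : l (fun=> 0) = 0 by apply: lW; exact: subW.1.
have lN f : D f -> l (fun x => -1 * f x + 0) = - l f.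
  move=> Df; transitivity (-1 * l f + l (fun=> 0)).
    exact: (linl (-1) f (fun=> 0) Df subD.1).
  by rewrite l0 addr0 mulN1r.
have lnorm f M : D f -> (forall x, K x -> `|f x| <= M) -> `|l f| <= M.
  move=> Df fM; rewrite ler_norml lerNl; apply/andP; split; last first.
    apply: le_trans (lp f Df) _; apply: ple => x Kx.
    exact: le_trans (ler_norm _) (fM x Kx).
  have DNf : D (fun x => -1 * f x + 0) := subD.2 (-1) f (fun=> 0) Df subD.1.
  rewrite -lN//; apply: le_trans (lp _ DNf) _; apply: ple => x Kx.
  by rewrite addr0 mulN1r; apply: le_trans (fM x Kx); rewrite -normrN ler_norm.
have lT := @invariant_functional_eq0 R N V A V_smooth V_gt0 A_smooth A_sym A_psd
  N_gt0 L_hypo K l cK.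
have [phi tphi phi0] := exists_test_function_gt0 cK.
have l_phi : l phi = 0.
  apply: lT => //.
  - by move=> a f g tf tg; apply: (linl a f g); exact: testD.
  - by move=> f M tf; apply: lnorm; exact: testD.
  - by move=> psi tpsi; apply: lW; exists psi.
have Kne : K !=set0 by exists x0.
have wphi : {within K, continuous phi}.
  exact/continuous_subspaceT/smooth_setT_continuous/tphi.1.
have [c Kc cmin] := compact_EVT_min Kne cK wphi.
(* [l] vanishes on [phi], but it is at most the supremum of [- phi] at [- phi].
   *)
have : l (fun x => -1 * phi x + 0) <= - phi c.
  apply: le_trans (lp _ _) _; first exact/testD/test_function_linear.
  apply: ple => x Kx; rewrite addr0 mulN1r lerN2; apply: cmin.
  by rewrite inE.
rewrite lN ?l_phi ?oppr0; last exact: testD.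
by rewrite oppr_ge0 leNgt phi0//; rewrite inE in Kc.
Qed.

End strict_subsolutions.

(** * Weak maximum principle *)

Section maximum_principle.
Context {R : realType} {N : nat}.
Local Notation E := 'rV[R]_N.
Variables (V : E -> R) (A : E -> 'M[R]_N) (c : E -> R).
Hypotheses (V_smooth : smooth setT V) (V_gt0 : forall x, 0 < V x).
Hypothesis A_smooth : forall i j, smooth setT (fun x => A x i j).
Hypothesis A_sym : forall x, (A x)^T = A x.
Hypothesis A_psd : forall x, psd_mx (A x).
Hypothesis c_ge0 : forall x, 0 <= c x.
Variables (Omega : set E) (phi : E -> R).
Hypotheses (oO : open Omega) (bO : bounded_set Omega).
Hypothesis phi_test : test_function setT phi.
Hypothesis phi_sub : forall x, closure Omega x -> 0 < div_op V A phi x.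

Lemma bounded_closure_compact : compact (closure Omega).
Proof.
apply: bounded_closed_compact; last exact: closed_closure.
have [M [_ OM]] := bO.
exists (M + 1); split; first exact: num_real.
move=> M' MM' x cx /=; rewrite leNgt; apply/negP => M'x.
have e0 : 0 < `|x| - M' by rewrite subr_gt0.
have [y [Oy]] := cx _ (nbhsx_ballx x _ e0).
rewrite -ball_normE /ball_/= => xy.
have := OM M'; rewrite (lt_trans _ MM') ?ltrDl// => /(_ isT y Oy) /= yM.
have := ler_distD y x 0; rewrite !subr0; lra.
Qed.

Lemma limf_esup_lt (u : E -> R) (x0 : E) (m : R) :
  (limf_esup (EFin \o u) (within Omega (nbhs x0)) <= 0)%E -> 0 < m ->
  \forall x \near x0, Omega x -> u x < m.
Proof.
move=> ls m0.
have : (limf_esup (EFin \o u) (within Omega (nbhs x0)) < m%:E)%E.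
  by apply: le_lt_trans ls _; rewrite lte_fin.
move=> /ereal_inf_lt[_ [B Bx0 <-] Bm].
have {}Bx0 : \forall x \near x0, Omega x -> B x := Bx0.
near=> x => Ox; have xB : Omega x -> B x by near: x.
rewrite -lte_fin; apply: le_lt_trans Bm.
by apply: ereal_sup_ubound; exists x => //; exact: xB.
Unshelve. all: by end_near. Qed.

(** Adding a small multiple of [phi - C], which is nonpositive, to [u] makes the
    differential inequality strict and preserves the boundary condition; a positive
    maximum would be attained inside [Omega] and contradict [div_op_max]. *)
Theorem weak_maximum_principle_of_subsolution :
  weak_maximum_principle (div_op_sub V A c) Omega.
Proof.
move=> u ku Lu ub x1 Ox1; rewrite leNgt; apply/negP => ux1.
have cK := bounded_closure_compact.
have [C C0 phiC] :=
  continuous_compact_bounded (smooth_setT_continuous phi_test.1) cK.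
(* As [`|phi|] is at most [C], this lowers [u] by at most half of [u x1] at
   [x1]. *)
pose eps := u x1 / (4 * C).
have eps0 : 0 < eps by rewrite divr_gt0// mulr_gt0.
pose w x := eps * phi x + (1 * u x + - (eps * C)).
have wu x : closure Omega x -> w x <= u x.
  move=> /phiC/ler_normlP[_ h]; rewrite /w mul1r.
  have : eps * phi x <= eps * C by rewrite ler_wpM2l// ltW.
  lra.
have OK : Omega `<=` closure Omega by exact: subset_closure.
have wx1 : 0 < w x1.
  have /ler_normlP[h _] := phiC _ (OK _ Ox1); rewrite /w mul1r.
  have : eps * - phi x1 <= eps * C by rewrite ler_wpM2l// ltW.
  have : eps * C = u x1 / 4 by rewrite /eps; field; rewrite gt_eqF.
  lra.
have kphi : Ck 2 Omega phi := Ck_subset (@subsetT _ Omega) (phi_test.1 2%N).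
have kcst : Ck 2 Omega (fun=> - (eps * C)) by exact: Ck_cst.
have ku1 : Ck 2 Omega (fun x => 1 * u x + - (eps * C)).
  by apply: (CkD oO _ kcst); exact: CkZ.
have kw : Ck 2 Omega w by apply: (CkD oO _ ku1); exact: CkZ.
(* A superlevel set of [w] in [Omega] stays away from the boundary, hence is
   compact. *)
pose S := [set x | Omega x /\ w x1 <= w x].
have cS : compact S.
  apply: (subclosed_compact _ cK); last by move=> x [/OK].
  move=> x Sx.
  have cx : closure Omega x by apply: (closureS _ Sx) => y [].
  have [Ox|Ox] := pselect (Omega x).
    split=> //; rewrite leNgt; apply/negP => wx.
    have cw : w y @[y --> x] --> w x := Ck_continuous kw Ox.
    have wx0 : 0 < w x1 - w x by rewrite subr_gt0.
    move/cvgrPdist_lt : cw => /(_ _ wx0) /Sx [y [[_ wy]]] /=.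
    by rewrite ltr_norml; lra.
  have bx : boundary Omega x by split => //; rewrite ((interior_id _).1 oO).
  have /Sx[y [[Oy wy] /(_ Oy) uy]] := limf_esup_lt (ub x bx) wx1.
  by have := wu _ (OK _ Oy); lra.
have Sne : S !=set0 by exists x1.
have wS : {within S, continuous w}.
  apply: continuous_in_subspaceT => x; rewrite inE => -[Ox _].
  exact: Ck_continuous kw Ox.
have [x Sx xmax] := compact_EVT_max Sne cS wS.
move: Sx; rewrite inE => -[Ox wx].
have wmax y : Omega y -> w y <= w x.
  move=> Oy; have [wy|wy] := leP (w x1) (w y); first by apply: xmax; rewrite inE.
  exact: le_trans (ltW wy) wx.
have h1 : 0 < eps * div_op V A phi x by rewrite mulr_gt0// phi_sub//; exact: OK.
have h2 : 0 <= c x * u x.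
  by rewrite mulr_ge0// (le_trans _ (wu _ (OK _ Ox)))// (le_trans (ltW wx1)).
have h3 := Lu x Ox; rewrite /div_op_sub subr_ge0 in h3.
have := div_op_max V_smooth V_gt0 A_smooth (A_sym x) (A_psd x) oO kw Ox wmax.
rewrite /w (div_op_linear V_smooth A_smooth eps oO kphi ku1 Ox).
rewrite (div_op_linear V_smooth A_smooth 1 oO ku kcst Ox) div_op_cst.
by move: (div_op V A phi x) (div_op V A u x) h1 h3 => a b h1 h3; lra.
Qed.

(** Otherwise [phi] would have a maximum in [Omega], against [div_op_max]. *)
Lemma boundary_nonempty : Omega !=set0 -> boundary Omega !=set0.
Proof.
move=> [x0 Ox0]; apply: contrapT => bd0.
have OK : Omega `<=` closure Omega by exact: subset_closure.
have KO x : closure Omega x -> Omega x.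
  move=> cx; apply: contrapT => Ox; apply: bd0; exists x.
  by split => //; rewrite ((interior_id _).1 oO).
have Kne : closure Omega !=set0 by exists x0; exact: OK.
have wphi : {within closure Omega, continuous phi}.
  exact/continuous_subspaceT/smooth_setT_continuous/phi_test.1.
have [x Kx xmax] := compact_EVT_max Kne bounded_closure_compact wphi.
rewrite inE in Kx; have Ox := KO _ Kx.
have phimax y : Omega y -> phi y <= phi x.
  by move=> /OK Ky; apply: xmax; rewrite inE.
have kphi : Ck 2 Omega phi := Ck_subset (@subsetT _ Omega) (phi_test.1 2%N).
have := div_op_max V_smooth V_gt0 A_smooth (A_sym x) (A_psd x) oO kphi Ox phimax.
by rewrite leNgt phi_sub.
Qed.

(** The maximum principle applies to [u - M], where [M] is the maximum of [u] on the
    boundary: as [M] and [c] are nonnegative, subtracting [M] preserves the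
    differential inequality. *)
Theorem sup_closure_eq_sup_boundary (u : E -> R) :
  Ck 2 Omega u -> {within closure Omega, continuous u} ->
  (forall x, closure Omega x -> 0 <= u x) ->
  (forall x, Omega x -> 0 <= div_op_sub V A c u x) ->
  ereal_sup [set (u x)%:E | x in closure Omega] =
  ereal_sup [set (u x)%:E | x in boundary Omega].
Proof.
move=> ku cu u0 Lu.
have OK : Omega `<=` closure Omega by exact: subset_closure.
have bK : boundary Omega `<=` closure Omega by move=> x [].
apply/eqP; rewrite eq_le; apply/andP; split; last first.
  by apply: ereal_sup_le; exact: image_subset.
have [One|O0] := pselect (Omega !=set0); last first.
  have -> : Omega = set0.
    by apply/seteqP; split => // x Ox; apply: O0; exists x.
  by rewrite /boundary closure0 set0D.
have cK := bounded_closure_compact.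
have cb : compact (boundary Omega).
  apply: (subclosed_compact _ cK bK).
  rewrite /boundary setDE; apply: closedI; first exact: closed_closure.
  exact/open_closedC/open_interior.
have cub : {within boundary Omega, continuous u} by exact: continuous_subspaceW cu.
have [y By ymax] := compact_EVT_max (boundary_nonempty One) cb cub.
rewrite inE in By.
have M0 : 0 <= u y by exact/u0/bK.
have vmax x : Omega x -> u x <= u y.
  have kcst : Ck 2 Omega (fun=> - u y) by exact: Ck_cst.
  move=> Ox; rewrite -subr_le0 -[u x]mul1r; move: x Ox.
  apply: weak_maximum_principle_of_subsolution.
  - by apply: (CkD oO _ kcst); exact: CkZ.
  - move=> x Ox; rewrite /div_op_sub.
    rewrite (div_op_linear V_smooth A_smooth 1 oO ku kcst Ox) div_op_cst.
    have Lux := Lu x Ox; rewrite /div_op_sub subr_ge0 in Lux.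
    rewrite !mul1r addr0 subr_ge0; apply: le_trans Lux.
    by rewrite ler_wpM2l// gerBl.
  move=> x0 Bx0; apply/lee_addgt0Pr => e e0; rewrite add0e.
  have : \forall x \near within (closure Omega) (nbhs x0), u x < u y + e.
    have cx0 : u x @[x --> within (closure Omega) (nbhs x0)] --> u x0.
      by move/subspace_continuousP : cu => /(_ x0 (bK _ Bx0)).
    move/cvgrPdist_lt : cx0 => /(_ _ e0); apply: filterS => x.
    have : u x0 <= u y by apply: ymax; rewrite inE.
    by rewrite ltr_norml; lra.
  move=> H; apply: ge_ereal_inf.
  exists (ereal_sup ((EFin \o (fun x => 1 * u x + - u y)) @`
      [set x | Omega x /\ u x < u y + e])).
    exists [set x | Omega x /\ u x < u y + e] => //.
    suff : \forall x \near x0, Omega x -> Omega x /\ u x < u y + e by [].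
    have {}H : \forall x \near x0, closure Omega x -> u x < u y + e := H.
    near=> x => Ox; split => //.
    have ux : closure Omega x -> u x < u y + e by near: x.
    exact/ux/OK.
  apply: ge_ereal_sup => _ [x [_ ux] <-] /=; rewrite lee_fin; lra.
apply: ge_ereal_sup => _ [x Kx <-].
apply: (@le_trans _ _ (u y)%:E); last by apply: ereal_sup_ubound; exists y.
rewrite lee_fin; have [/vmax//|Ox] := pselect (Omega x).
by apply: ymax; rewrite inE; split => //; rewrite ((interior_id _).1 oO).
Unshelve. all: by end_near. Qed.

End maximum_principle.

Unset Implicit Arguments.
Set Strict Implicit.
Set Printing Implicit Defensive.

Theorem corollary2p3 (R : realType) (N : nat)
    (V : 'rV[R]_N -> R) (A : 'rV[R]_N -> 'M[R]_N) (c : 'rV[R]_N -> R)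
    (V_smooth : smooth setT V) (V_gt0 : forall x, 0 < V x)
    (A_smooth : forall i j, smooth setT (fun x => A x i j))
    (A_sym : forall x, (A x)^T = A x)
    (A_psd : forall x, psd_mx (A x))
    (A_neq0 : forall x, A x <> 0)
    (L_hypo : forall Omega : set 'rV[R]_N, open Omega ->
       hypoelliptic (div_op_distr V A) Omega)
    (c_smooth : smooth setT c) (c_ge0 : forall x, 0 <= c x) :
  (forall Omega : set 'rV[R]_N, open Omega -> bounded_set Omega ->
     weak_maximum_principle (div_op_sub V A c) Omega) /\
  (forall Omega : set 'rV[R]_N, open Omega -> bounded_set Omega ->
   forall u : 'rV[R]_N -> R,
     Ck 2 Omega u -> {within closure Omega, continuous u} ->
     (forall x, closure Omega x -> 0 <= u x) ->
     (forall x, Omega x -> 0 <= div_op_sub V A c u x) ->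
     ereal_sup [set (u x)%:E | x in closure Omega] =
     ereal_sup [set (u x)%:E | x in boundary Omega]).
Proof.
(* In dimension 0 every matrix is zero. *)
have N_gt0 : (0 < N)%N.
  case: N V A c V_smooth V_gt0 A_smooth A_sym A_psd A_neq0 L_hypo c_smooth c_ge0 => //.
  move=> V' A' c' _ _ _ _ _ A_neq0' _ _ _.
  by have := A_neq0' 0; rewrite [A' 0]flatmx0.
have sub (Omega : set 'rV[R]_N) : bounded_set Omega ->
    exists2 phi, test_function setT phi &
      forall x, closure Omega x -> 0 < div_op V A phi x.
  move=> bO; apply: strict_subsolution => //; first exact/L_hypo/openT.
  exact: bounded_closure_compact.
split=> Omega oO bO; have [phi tphi phi_sub] := sub Omega bO.
  exact: weak_maximum_principle_of_subsolution phi_sub.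
move=> u ku cu u0 Lu.
exact: (sup_closure_eq_sup_boundary V_smooth V_gt0 A_smooth A_sym A_psd c_ge0
  oO bO tphi phi_sub).
Qed.
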